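(* Let $Z=2P_1+\cdots+2P_{n+3}$ be a set of $n+3$ non-degenerate double points in $\mathbb P^n$ (with $P_1,\dots,P_{n+3}$ distinct). Then $$\operatorname{reg}(Z)=T(Z),$$ where $$T(Z)=\max\{T_j(Z)\mid j=1,\dots,n\},$$ $$T_j(Z)=\max\left\{\left[\frac{2q+j-2}{j}\right]\ \Big|\ P_{i_1},\dots,P_{i_q}\text{ lie on a }j\text{-dimensional linear subspace}\right\}.$$
   Context: $K$ is an algebraically closed field of arbitrary characteristic and $\mathbb P^n=\mathbb P^n_K$, with homogeneous coordinate ring $R=K[X_0,\dots,X_n]$. For distinct points $P_1,\dots,P_s\in\mathbb P^n$ with homogeneous prime ideals $\wp_1,\dots,\wp_s\subset R$, the set of double points $Z=2P_1+\cdots+2P_s$ is the zero-dimensional scheme defined by $I=\wp_1^{2}\cap\cdots\cap\wp_s^{2}$. It is non-degenerate in $\mathbb P^n$ if $P_1,\dots,P_s$ span $\mathbb P^n$. The regularity index $\operatorname{reg}(Z)$ is the least integer $t$ such that $\dim_K(R/I)_t=s\binom{n+1}{n}=s(n+1)$. $[a]$ denotes the integer part of a rational number $a$. In the definition of $T_j(Z)$ the maximum is over all subsets $\{P_{i_1},\dots,P_{i_q}\}$ of $q$ distinct points among the given points that are contained in some $j$-dimensional linear subspace of $\mathbb P^n$. *)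

(* Defs.v *)
From HB Require Import structures.
From mathcomp Require Import all_boot all_order all_algebra.
From mathcomp Require Import boolp mpoly.

Set Implicit Arguments.
Unset Strict Implicit.
Unset Printing Implicit Defensive.

Import GRing.Theory.
Local Open Scope ring_scope.

Definition ideal_gen (R : comNzRingType) (S : R -> Prop) (f : R) : Prop :=
  exists (r : nat) (a b : 'I_r -> R),
    (forall k, S (b k)) /\ f = \sum_(k < r) a k * b k.

Definition ideal_sqr (R : comNzRingType) (J : R -> Prop) : R -> Prop :=
  ideal_gen (fun f => exists g h, [/\ J g, J h & f = g * h]).

(* A point of P^n is given by a nonzero vector of homogeneous coordinates; two
   vectors give the same point when they span the same line. *)
Definition distinct_points (K : fieldType) (n s : nat)
    (P : 'I_s -> 'rV[K]_n.+1) : Prop :=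
  (forall i, P i != 0) /\ injective (fun i => <[P i]>%VS).

Definition nondegenerate_points (K : fieldType) (n s : nat)
    (P : 'I_s -> 'rV[K]_n.+1) : Prop :=
  (\sum_(i < s) <[P i]>)%VS = fullv.

(* The generators are forms, so the ideal depends only on the line spanned by
   p. *)
Definition point_ideal (K : fieldType) (n : nat) (p : 'rV[K]_n.+1) :
    {mpoly K[n.+1]} -> Prop :=
  ideal_gen (fun g => (exists d : nat, g \is d.-homog) /\
                      g.@[fun i => p ord0 i] = 0).

Definition double_points_ideal (K : fieldType) (n s : nat)
    (P : 'I_s -> 'rV[K]_n.+1) (f : {mpoly K[n.+1]}) : Prop :=
  forall i : 'I_s, ideal_sqr (point_ideal (P i)) f.

(* The dimension of (R/I)_t is d: the subspace I_t of R_t has codimension d,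
   where R_t is the type [dhomog n.+1 K t] of forms of degree t. *)
Definition graded_quotient_dim (K : fieldType) (n : nat)
    (I : {mpoly K[n.+1]} -> Prop) (t d : nat) : Prop :=
  exists It : {vspace (dhomog n.+1 K t)},
    (forall f : dhomog n.+1 K t, f \in It <-> I (mpoly_of_dhomog f)) /\
    (d + \dim It = \dim {:dhomog n.+1 K t})%N.

(* Negative degrees are omitted: (R/I)_t is 0 there, while s * (n + 1) > 0 as
   soon as there is a point. *)
Definition is_regularity_index (K : fieldType) (n s : nat)
    (P : 'I_s -> 'rV[K]_n.+1) (t : nat) : Prop :=
  let full_dim u :=
    graded_quotient_dim (double_points_ideal P) u (s * n.+1)%N in
  full_dim t /\ forall u : nat, full_dim u -> (t <= u)%N.

(* A j-dimensional linear subspace of P^n is a (j+1)-dimensional subspace of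
   K^(n+1). *)
Definition on_linear_subspace (K : fieldType) (n s : nat)
    (P : 'I_s -> 'rV[K]_n.+1) (j : nat) (A : {set 'I_s}) : Prop :=
  exists L : {vspace 'rV[K]_n.+1},
    \dim L = j.+1 /\ forall i, i \in A -> P i \in L.

(* For j > 0 the subtraction is truncated only when A is empty and j = 1; this
   does not affect the maximum when there is at least one point. *)
Definition T_sub (K : fieldType) (n s : nat)
    (P : 'I_s -> 'rV[K]_n.+1) (j : nat) : nat :=
  \max_(A : {set 'I_s} | `[< on_linear_subspace P j A >])
    ((2 * #|A| + j - 2) %/ j)%N.

Definition T_max (K : fieldType) (n s : nat) (P : 'I_s -> 'rV[K]_n.+1) : nat :=
  \max_(1 <= j < n.+1) T_sub P j.

(* Main.v *)
Require Import Defs.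
From HB Require Import structures.
From mathcomp Require Import all_boot all_order all_algebra.
From mathcomp Require Import boolp mpoly ring zify.

(* In degree t the quotient has full dimension iff the forms of degree t
   separate 1-jets: every 1-jet at one point that satisfies Euler's relation is
   attained by a form singular at all other points. Choose n + 1 of the points
   as coordinate points e_i, let u, v be the two others, and put
   [i j] = u_i v_j - u_j v_i.

   Upper bound: the jets at u are attained by products of t linear forms such
   that every other point lies on two of the hyperplanes. The factors are
   coordinates, forms v_j x_i - v_i x_j with [i j] <> 0, and u_r x_k - u_k x_r,
   which gives the cotangent directions at u. The relation [i j] = 0 is an
   equivalence on the union of the supports of u and v, and the factors exist
   as soon as the classes and supports are large enough. Otherwise a support, a
   union of supports or a complement of a class spans a small linear subspace
   that contains many of the points, so T is large.

   Lower bound: if q points span a (r-1)-dimensional subspace, then q <= r + 2,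
   and restriction to this subspace leaves forms in r variables. If they are
   singular at the r coordinate points, their monomials have exponents at most
   e = t - 2. On the rational normal curve x_i = 1/(y/u_i + z/v_i) such a form
   is, up to a fixed factor, a binary form of degree r e - t. In the critical
   cases this degree is at most 2, so its 1-jets at the parameters of u and v
   satisfy a linear relation; written without denominators, the relation holds
   for all u, v. *)

Set Implicit Arguments.
Unset Strict Implicit.
Unset Printing Implicit Defensive.

Import GRing.Theory.
Local Open Scope ring_scope.

Local Notation ev f p := (f.@[fun i => p ord0 i]).
Local Notation dv k f p := ((f^`M(k)).@[fun i => p ord0 i]).

(** * Double points and 1-jets *)

(** The value is required separately, since Euler's formula recovers it only when the degree is
    nonzero in K. *)
Definition singular_at (K : fieldType) (n : nat) (f : {mpoly K[n]})
    (p : 'rV[K]_n) : Prop :=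
  ev f p = 0 /\ forall k, dv k f p = 0.

Lemma mpoly_ring_ind (R : comNzRingType) (n : nat) (Q : {mpoly R[n]} -> Prop) :
  (forall c, Q c%:MP) -> (forall i, Q 'X_i) ->
  (forall f g, Q f -> Q g -> Q (f + g)) ->
  (forall f g, Q f -> Q g -> Q (f * g)) ->
  forall f, Q f.
Proof.
move=> QC QX QD QM f; elim/mpolyind: f => [|c m f _ _ Qf]; first by rewrite -mpolyC0.
apply: QD => //; rewrite -mul_mpolyC; apply: (QM) => //.
rewrite mpolyXE_id; elim/big_rec: _ => [|i g _ Qg]; first by rewrite -mpolyC1.
apply: (QM) => //; elim: (m i) => [|k IH]; first by rewrite expr0 -mpolyC1.
by rewrite exprS; apply: (QM).
Qed.

Section IdealGen.
Variables (R : comNzRingType) (S : R -> Prop).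

Lemma ideal_genM a f : ideal_gen S f -> ideal_gen S (a * f).
Proof.
case=> r [x [y [Sy ->]]]; exists r, (fun k => a * x k), y; split => //.
by rewrite mulr_sumr; apply: eq_bigr => k _; rewrite mulrA.
Qed.

Lemma ideal_genD f g :
  ideal_gen S f -> ideal_gen S g -> ideal_gen S (f + g).
Proof.
case=> r [x [y [Sy ->]]] [r' [x' [y' [Sy' ->]]]].
exists (r + r')%N, (fun k => match split k with inl i => x i | inr i => x' i end),
  (fun k => match split k with inl i => y i | inr i => y' i end); split.
  by move=> k; case: (split k).
rewrite big_split_ord /=; congr (_ + _); apply: eq_bigr => k _.
  by rewrite (unsplitK (inl k)).
by rewrite (unsplitK (inr k)).
Qed.

Lemma ideal_gen0 : ideal_gen S 0.
Proof. by exists 0%N, (fun=> 0), (fun=> 0); split; [case | rewrite big_ord0]. Qed.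

Lemma ideal_gen_sub f : S f -> ideal_gen S f.
Proof.
by move=> Sf; exists 1%N, (fun=> 1), (fun=> f); split=> //; rewrite big_ord1 mul1r.
Qed.

Lemma ideal_gen_sum (I : finType) (F : I -> R) :
  (forall i, ideal_gen S (F i)) -> ideal_gen S (\sum_i F i).
Proof.
by move=> SF; elim/big_rec: _ => [|i f _ Sf];
  [apply: ideal_gen0 | apply: ideal_genD].
Qed.

End IdealGen.

Lemma dhomog_mderiv (K : fieldType) (n t : nat) (f : {mpoly K[n]}) k :
  f \is t.-homog -> f^`M(k) \is t.-1.-homog.
Proof.
move=> /dhomogP hf; apply/dhomogP => m; rewrite mcoeff_msupp mcoeff_deriv => nz.
have: (m + U_(k))%MM \in msupp f.
  by rewrite mcoeff_msupp; apply: contraNneq nz => ->; rewrite mul0rn.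
by move=> /hf /=; rewrite mdegD mdeg1 => <-; rewrite addn1.
Qed.

Lemma meval_mderivXU (K : fieldType) (n : nat) (i j : 'I_n) (p : 'rV[K]_n) :
  dv i 'X_j p = (i == j)%:R.
Proof.
rewrite mderivX mevalZ mnm1E eq_sym; case: eqVneq => [->|_]; last by rewrite mul0r.
by rewrite mevalX big1 ?mulr1 // => l _; rewrite mnmBE subnn.
Qed.

Lemma euler (K : fieldType) (n t : nat) (f : {mpoly K[n]}) (p : 'rV[K]_n) :
  f \is t.-homog -> \sum_k p ord0 k * dv k f p = t%:R * ev f p.
Proof.
move=> /dhomogP hf; rewrite (mpolyE f).
rewrite (eq_bigr (fun k => \sum_(m <- msupp f)
   f@_m * (p ord0 k * dv k 'X_[m] p))); last first.
  move=> k _; rewrite (raddf_sum (mderiv k)) (raddf_sum (meval _)) /= mulr_sumr.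
  apply: eq_bigr => m _.
  by rewrite mderivZ mevalZ mulrCA.
rewrite exchange_big raddf_sum /= mulr_sumr; apply: eq_big_seq => m mf.
rewrite -mulr_sumr mevalZ mulrCA; congr (_ * _).
rewrite -(hf m mf) /= mdegE natr_sum mulr_suml; apply: eq_bigr => k _.
rewrite mderivX mevalZ !mevalX mulrCA; case: (posnP (m k)) => [->|mk].
  by rewrite !mul0r.
congr (_ * _); rewrite (bigD1 k) //= [RHS](bigD1 k) //= mulrA; congr (_ * _).
  by rewrite mnmBE mnm1E eqxx -exprS subn1 prednK.
by apply: eq_bigr => i ik; rewrite mnmBE mnm1E eq_sym (negbTE ik) subn0.
Qed.

(** * Taylor expansion modulo the square of an ideal *)

Section Taylor.
Variables (K : fieldType) (n m : nat) (J : {mpoly K[m]} -> Prop).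
Variables (a b : 'I_n -> {mpoly K[m]}).
Hypothesis Jb : forall i, J (b i).

Let A : n.-tuple {mpoly K[m]} := [tuple a i | i < n].
Let AB : n.-tuple {mpoly K[m]} := [tuple a i + b i | i < n].
Let I2 := ideal_sqr J.

(** The error is additive in f, and for a product the only new term is the product of the two linear
    parts, a combination of the [b i * b j]. *)
Lemma taylor1 (f : {mpoly K[n]}) :
  I2 ((f \mPo AB) - (f \mPo A) - \sum_i (f^`M(i) \mPo A) * b i).
Proof.
elim/mpoly_ring_ind: f => [c|i|f g If Ig|f g If Ig].
- rewrite !comp_mpolyC subrr sub0r big1 ?oppr0; first exact: ideal_gen0.
  by move=> i _; rewrite mderivC comp_mpoly0 mul0r.
- rewrite !comp_mpolyXU -!tnth_nth !tnth_mktuple.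
  rewrite (bigD1 i) //= big1 ?addr0.
    rewrite mderivX mnm1E eqxx scale1r (_ : (U_(i) - U_(i))%MM = 0%MM); last first.
      by apply/mnmP => j; rewrite mnmBE subnn mnm0E.
    rewrite mpolyX0 comp_mpoly1 mul1r (addrC (a i)) addrK subrr; exact: ideal_gen0.
  by move=> k ki; rewrite mderivX mnm1E eq_sym (negbTE ki) scale0r comp_mpoly0 mul0r.
- rewrite !comp_mpolyD.
  rewrite (eq_bigr (fun i => (f^`M(i) \mPo A) * b i + (g^`M(i) \mPo A) * b i));
    last by move=> i _; rewrite mderivD comp_mpolyD mulrDl.
  rewrite big_split /=.
  have addE (f1 f2 f3 g1 g2 g3 : {mpoly K[m]}) :
    f1 - f2 - f3 + (g1 - g2 - g3) = f1 + g1 - (f2 + g2) - (f3 + g3) by ring.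
  by have := ideal_genD If Ig; rewrite addE.
- rewrite !rmorphM /=.
  rewrite (eq_bigr (fun i => (g \mPo A) * ((f^`M(i) \mPo A) * b i) +
       (f \mPo A) * ((g^`M(i) \mPo A) * b i))); last first.
    by move=> i _; rewrite mderivM comp_mpolyD !rmorphM /=; ring.
  rewrite big_split /= -!mulr_sumr.
  set Sf := \sum_i _ in If *; set Sg := \sum_i _ in Ig *.
  have IS : I2 (Sf * Sg).
    rewrite mulr_suml; apply: ideal_gen_sum => i.
    rewrite mulr_sumr; apply: ideal_gen_sum => j.
    rewrite mulrACA; apply: ideal_genM; apply: ideal_gen_sub.
    by exists (b i), (b j).
  have := ideal_genD (ideal_genD (ideal_genM (g \mPo AB) If)
     (ideal_genM ((f \mPo A) + Sf) Ig)) IS.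
  have mulE (f1 f2 f3 g1 g2 g3 : {mpoly K[m]}) :
    g1 * (f1 - f2 - f3) + (f2 + f3) * (g1 - g2 - g3) + f3 * g3 =
    f1 * g1 - f2 * g2 - (g2 * f3 + f2 * g3) by ring.
  by rewrite mulE.
Qed.

End Taylor.

Lemma dhomog_scale_comp (K : fieldType) (n m t : nat) (f : {mpoly K[n]})
    (c : 'I_n -> K) (Y : {mpoly K[m]}) :
  f \is t.-homog ->
  f \mPo [tuple c i *: Y | i < n] = f.@[c] *: Y ^+ t.
Proof.
move=> /dhomogP hf; rewrite comp_mpolyE mevalE scaler_suml.
apply: eq_big_seq => /= d /hf hd; rewrite -scalerA; congr (_ *: _).
rewrite (eq_bigr (fun i => c i ^+ d i *: Y ^+ d i)); last first.
  by move=> i _; rewrite tnth_mktuple exprZn.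
by rewrite scaler_prod prodrXr -mdegE hd.
Qed.

(** The forward direction is the product rule. Conversely, if p_k is nonzero, X_i is (p_i / p_k) X_k
    plus an element of the point ideal; the Taylor coefficients of order 0 and 1 are the value and
    the partial derivatives at p times powers of X_k / p_k, so they vanish. *)
Lemma sqr_point_idealP (K : fieldType) (n t : nat) (f : {mpoly K[n.+1]})
    (p : 'rV[K]_n.+1) : p != 0 -> f \is t.-homog ->
  ideal_sqr (point_ideal p) f <-> singular_at f p.
Proof.
move=> p0 hf; split.
  have J0 g : point_ideal p g -> ev g p = 0.
    case=> r [a [b [Hb ->]]]; rewrite raddf_sum /= big1 // => k _.
    by rewrite mevalM (proj2 (Hb k)) mulr0.
  case=> r [a [b [Hb ->]]]; split=> [|i].
    rewrite raddf_sum /= big1 // => k _.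
    by case: (Hb k) => g [h [/J0 g0 _ ->]]; rewrite !mevalM g0 mul0r mulr0.
  rewrite (raddf_sum (mderiv i)) (raddf_sum (meval _)) /= big1 // => k _.
  case: (Hb k) => g [h [/J0 g0 /J0 h0 ->]].
  by rewrite !mderivM !(mevalD, mevalM) g0 h0 !(mul0r, mulr0, addr0).
case=> f0 df0.
have /rV0Pn[k pk] := p0.
pose a i : {mpoly K[n.+1]} := p ord0 i *: ((p ord0 k)^-1 *: 'X_k).
pose b i : {mpoly K[n.+1]} := 'X_i - a i.
have Jb i : point_ideal p (b i).
  apply: ideal_gen_sub; split.
    exists 1%N; rewrite /b /a rpredB ?rpredZ //; by rewrite dhomogX /= mdeg1.
  by rewrite mevalB !mevalZ !mevalXU mulVf // mulr1 subrr.
have := @taylor1 K _ _ _ a b Jb f.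
rewrite (_ : [tuple a i + b i | i < n.+1] = [tuple 'X_i | i < n.+1]); last first.
  by apply: eq_from_tnth => i; rewrite !tnth_mktuple /b addrC subrK.
rewrite comp_mpoly_id (dhomog_scale_comp _ _ hf) f0 scale0r subr0 big1 ?subr0 //.
by move=> i _; rewrite (dhomog_scale_comp _ _ (dhomog_mderiv i hf)) df0 scale0r mul0r.
Qed.

(** * Separation of 1-jets and the Hilbert function *)

Definition separates_jets (K : fieldType) (n s : nat) (P : 'I_s -> 'rV[K]_n)
    (t : nat) : Prop :=
  forall (i : 'I_s) (c : K) (y : 'I_n -> K),
    \sum_k P i ord0 k * y k = t%:R * c ->
    exists f : {mpoly K[n]},
      [/\ f \is t.-homog, ev f (P i) = c, forall k, dv k f (P i) = y k
        & forall j, j != i -> singular_at f (P j)].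

(* By Euler's formula, at a point whose coordinate [k0 i] is nonzero the partial
   derivative along [k0 i] is determined by the value and the other partial
   derivatives. *)
Definition jet_matrix (K : fieldType) (n s t : nat) (P : 'I_s -> 'rV[K]_n.+1)
    (k0 : 'I_s -> 'I_n.+1) (f : dhomog n.+1 K t) : 'M[K]_(s, n.+1) :=
  \matrix_(i, k) if k == k0 i then ev (val f) (P i) else dv k (val f) (P i).

Lemma jet_matrix_is_linear (K : fieldType) (n s t : nat)
    (P : 'I_s -> 'rV[K]_n.+1) k0 : linear (@jet_matrix K n s t P k0).
Proof.
move=> a f g; apply/matrixP => i k; rewrite !mxE; case: ifP => _ /=.
  by rewrite mevalD mevalZ.
by rewrite mderivD mderivZ mevalD mevalZ.
Qed.

HB.instance Definition _ (K : fieldType) (n s t : nat)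
    (P : 'I_s -> 'rV[K]_n.+1) k0 :=
  GRing.isLinear.Build K (dhomog n.+1 K t) 'M[K]_(s, n.+1) _
    (@jet_matrix K n s t P k0) (jet_matrix_is_linear P k0).

Lemma euler_jet_eq (K : fieldType) (n : nat) (p : 'rV[K]_n) (y z : 'I_n -> K) k0 :
  p ord0 k0 != 0 -> (forall k, k != k0 -> y k = z k) ->
  \sum_k p ord0 k * y k = \sum_k p ord0 k * z k -> forall k, y k = z k.
Proof.
move=> pk yz; rewrite (bigD1 k0) //= [RHS](bigD1 k0) //=.
rewrite (eq_bigr (fun k => p ord0 k * z k)); last first.
  by move=> k kk0; rewrite yz.
move=> /addIr /(mulfI pk) yz0 k; have [->//|] := eqVneq k k0; exact: yz.
Qed.

(** The kernel of [jet_matrix] is I_t and its target has dimension s (n + 1), so the quotient has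
    full dimension exactly when the map is onto. Matrices with one nonzero row generate the target,
    and reaching them is separation. *)
Lemma graded_quotient_dim_double_points (K : fieldType) (n s t : nat)
    (P : 'I_s -> 'rV[K]_n.+1) : (forall i, P i != 0) ->
  graded_quotient_dim (double_points_ideal P) t (s * n.+1)%N <->
  separates_jets P t.
Proof.
move=> P0.
have /choice [k0 Pk0] : forall i, exists k, P i ord0 k != 0.
  by move=> i; apply/rV0Pn.
pose J := linfun (@jet_matrix K n s t P k0).
have kerJ (f : dhomog n.+1 K t) :
    f \in lker J <-> double_points_ideal P (mpoly_of_dhomog f).
  have hf := dhomog_is_dhomog f.
  rewrite memv_ker lfunE /=; split=> [/eqP/matrixP J0 i|If].
    apply/(sqr_point_idealP (P0 i) hf).
    have f0 : ev (val f) (P i) = 0 by have := J0 i (k0 i); rewrite !mxE eqxx.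
    split=> // k.
    apply: (@euler_jet_eq K n.+1 (P i) (fun k => dv k (val f) (P i)) (fun=> 0) _ (Pk0 i)).
      by move=> l lk; have := J0 i l; rewrite !mxE (negbTE lk).
    rewrite (euler _ hf) f0 mulr0 big1 // => l _; exact: mulr0.
  apply/eqP/matrixP => i k; rewrite !mxE.
  have [f0 df0] := (sqr_point_idealP (P0 i) hf).1 (If i).
  by case: ifP.
have dimM : \dim {:'M[K]_(s, n.+1)} = (s * n.+1)%N by rewrite dimvf /dim /=.
split=> [[It [ItP dimIt]] i c y eul|sep].
  have ItE : It = lker J.
    by apply/vspaceP => f; apply/idP/idP => [/ItP/kerJ|/kerJ/ItP].
  have fullJ : limg J = fullv.
    apply/eqP; rewrite eqEdim subvf /= dimM -(leq_add2r (\dim (lker J))).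
    by rewrite -{1}ItE dimIt addnC -(limg_ker_dim J fullv) capfv.
  pose B : 'M[K]_(s, n.+1) :=
    \matrix_(j, k) if j == i then if k == k0 j then c else y k else 0.
  have: B \in limg J by rewrite fullJ memvf.
  case/memv_imgP => f _; rewrite lfunE /= => BE.
  have hf := dhomog_is_dhomog f.
  have fB j k : (if k == k0 j then ev (val f) (P j) else dv k (val f) (P j)) =
      if j == i then if k == k0 j then c else y k else 0.
    by have /matrixP/(_ j k) := BE; rewrite !mxE.
  have fc : ev (val f) (P i) = c by have := fB i (k0 i); rewrite !eqxx.
  exists (val f); split=> //.
    apply: (euler_jet_eq (Pk0 i)).
      by move=> l lk; have := fB i l; rewrite (negbTE lk) eqxx.
    by rewrite (euler _ hf) fc eul.
  move=> j ji.
  have f0 : ev (val f) (P j) = 0.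
    by have := fB j (k0 j); rewrite eqxx (negbTE ji).
  split=> // k.
  apply: (@euler_jet_eq K n.+1 (P j) (fun k => dv k (val f) (P j)) (fun=> 0) _ (Pk0 j)).
    by move=> l lk; have := fB j l; rewrite (negbTE lk) (negbTE ji).
  rewrite (euler _ hf) f0 mulr0 big1 // => l _; exact: mulr0.
exists (lker J); split=> //.
rewrite -dimM -(limg_ker_dim J fullv) capfv addnC; congr (_ + _)%N.
suff -> : limg J = fullv by [].
apply/vspaceP => B; rewrite memvf; apply/memv_imgP.
have /choice [F FP] : forall i, exists f : dhomog n.+1 K t, 
   jet_matrix P k0 f = \matrix_(j, k) if j == i then B j k else 0.
  move=> i.
  pose z k := if k == k0 i then 0 else B i k.
  (* The derivative along [k0 i], whose place in the matrix holds the value, is solved from Euler's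
     relation. *)
  pose y k := if k == k0 i then
    (t%:R * B i (k0 i) - \sum_k P i ord0 k * z k) / P i ord0 (k0 i) else B i k.
  have eul : \sum_k P i ord0 k * y k = t%:R * B i (k0 i).
    rewrite (bigD1 (k0 i)) //= {1}/y eqxx mulrC divfK //.
    rewrite [X in _ - X](bigD1 (k0 i)) //= {1}/z eqxx mulr0 add0r.
    rewrite -[RHS](subrK (\sum_(k | k != k0 i) P i ord0 k * z k)); congr (_ + _).
    by apply: eq_bigr => k kk0; rewrite /y /z (negbTE kk0).
  have [f [hf fc fy fs]] := sep i _ _ eul.
  exists (DHomog hf); apply/matrixP => j k; rewrite !mxE /=.
  have [->|ji] := eqVneq j i.
    by rewrite fc fy /y; case: eqVneq => [->|].
  by case: (fs j ji) => -> ->; case: ifP.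
exists (\sum_i F i); first exact: memvf.
rewrite lfunE linear_sum; apply/matrixP => j k.
rewrite summxE (bigD1 j) //= FP mxE eqxx big1 ?addr0 // => i ij.
by rewrite FP mxE eq_sym (negbTE ij).
Qed.

(** A solution for the jet divided by a coordinate that is nonzero at [P i] is multiplied by that
    coordinate. *)
Lemma separates_jetsS (K : fieldType) (n s t : nat) (P : 'I_s -> 'rV[K]_n) :
  (forall i, P i != 0) -> separates_jets P t -> separates_jets P t.+1.
Proof.
move=> P0 sep i c y eul; have /rV0Pn[k0 pk] := P0 i.
set a := P i ord0 k0 in pk.
have [|f [hf fc fy fs]] :=
    sep i (c / a) (fun k => (y k - (c / a) * (k0 == k)%:R) / a).
  rewrite (eq_bigr (fun k => a^-1 * (P i ord0 k * y k)
      - a^-1 * (c / a) * (P i ord0 k * (k0 == k)%:R))); last first.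
    by move=> k _; move: (_ %:R) => d; field.
  rewrite sumrB -!mulr_sumr eul [in X in _ - X](bigD1 k0) //= eqxx big1 ?addr0.
    rewrite -/a -natr1 mulr1n mulr1; by field.
  by move=> k kk; rewrite eq_sym (negbTE kk) mulr0.
exists (f * 'X_k0); split.
- by rewrite -addn1 dhomogM // dhomogX /= mdeg1.
- by rewrite mevalM mevalXU fc divfK.
- move=> k; rewrite mderivM mevalD !mevalM mevalXU fy fc meval_mderivXU -/a divfK //.
  by rewrite [k == k0]eq_sym subrK.
- move=> j ji; have [f0 df0] := fs j ji; split=> [|k].
    by rewrite mevalM f0 mul0r.
  by rewrite mderivM mevalD !mevalM df0 f0 !mul0r addr0.
Qed.

Lemma separates_jets_leq (K : fieldType) (n s t u : nat) (P : 'I_s -> 'rV[K]_n) :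
  (forall i, P i != 0) -> (t <= u)%N ->
  separates_jets P t -> separates_jets P u.
Proof.
move=> P0 /subnK <- sep; elim: (u - t)%N => // d; exact: separates_jetsS.
Qed.

(** * Linear substitutions and restriction to subspaces *)

Definition lin_subst (K : fieldType) (m n : nat) (N : 'M[K]_(m, n))
    (f : {mpoly K[n]}) : {mpoly K[m]} :=
  f \mPo [tuple \sum_i N i k *: 'X_i | k < n].

Lemma lin_substE (K : fieldType) (m n : nat) (N : 'M[K]_(m, n)) f (x : 'rV_m) :
  ev (lin_subst N f) x = ev f (x *m N).
Proof.
rewrite /lin_subst comp_mpoly_meval; apply: meval_eq => k.
rewrite tnth_mktuple raddf_sum mxE; apply: eq_bigr => i _ /=.
by rewrite mevalZ mevalXU mulrC.
Qed.

Lemma lin_subst_deriv (K : fieldType) (m n : nat) (N : 'M[K]_(m, n)) f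
    (x : 'rV_m) i :
  dv i (lin_subst N f) x = \sum_k N i k * dv k f (x *m N).
Proof.
elim/mpoly_ring_ind: f => [c|k|f g IHf IHg|f g IHf IHg].
- rewrite /lin_subst comp_mpolyC mderivC meval0 big1 // => k _.
  by rewrite mderivC meval0 mulr0.
- rewrite /lin_subst comp_mpolyXU -tnth_nth tnth_mktuple.
  rewrite (raddf_sum (mderiv i)) (raddf_sum (meval _)) /=.
  rewrite (bigD1 i) //= big1 ?addr0; last first.
    by move=> j ji; rewrite mderivZ mevalZ meval_mderivXU eq_sym (negbTE ji) mulr0.
  rewrite (bigD1 k) //= big1 ?addr0; last first.
    by move=> j ji; rewrite meval_mderivXU (negbTE ji) mulr0.
  by rewrite mderivZ mevalZ !meval_mderivXU !eqxx.
- have -> : lin_subst N (f + g) = lin_subst N f + lin_subst N g.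
    exact: comp_mpolyD.
  rewrite mderivD mevalD IHf IHg -big_split; apply: eq_bigr => k _ /=.
  by rewrite mderivD mevalD mulrDr.
- have -> : lin_subst N (f * g) = lin_subst N f * lin_subst N g.
    exact: rmorphM.
  rewrite mderivM mevalD !mevalM IHf IHg !lin_substE mulr_suml mulr_sumr.
  rewrite -big_split; apply: eq_bigr => k _ /=.
  by rewrite mderivM mevalD !mevalM; ring.
Qed.

Lemma lin_subst_dhomog (K : fieldType) (m n t : nat) (N : 'M[K]_(m, n)) f :
  f \is t.-homog -> lin_subst N f \is t.-homog.
Proof.
move=> /dhomogP hf; rewrite /lin_subst comp_mpolyE big_seq rpred_sum //.
move=> d /hf /= hd; apply: rpredZ.
have hX k : \sum_i N i k *: 'X_i \is 1.-homog.
  by apply: rpred_sum => i _; rewrite rpredZ // dhomogX /= mdeg1.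
rewrite -hd mdegE; elim/big_ind2: _ => [||i _].
- exact: dhomog1.
- by move=> p e q e' hp hq; apply: dhomogM.
- by have := dhomogMn (d i) (hX i); rewrite tnth_mktuple mul1n.
Qed.

Lemma lin_subst_singular (K : fieldType) (m n : nat) (N : 'M[K]_(m, n)) f
    (x : 'rV_m) : singular_at f (x *m N) -> singular_at (lin_subst N f) x.
Proof.
case=> f0 df0; split=> [|i]; first by rewrite lin_substE.
by rewrite lin_subst_deriv big1 // => k _; rewrite df0 mulr0.
Qed.

(** A jet on the subspace spanned by the rows of [N] is lifted to the ambient space through a right
    inverse of [N], which keeps Euler's relation; the ambient form is then pulled back. *)
Lemma separates_jets_restrict (K : fieldType) (n s t r : nat)
    (P : 'I_s -> 'rV[K]_n) (N : 'M[K]_(r, n)) i (u : 'rV_r) c (y : 'I_r -> K) :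
  separates_jets P t -> row_free N -> P i = u *m N ->
  \sum_k u ord0 k * y k = t%:R * c ->
  exists g : {mpoly K[r]},
    [/\ g \is t.-homog, ev g u = c, forall k, dv k g u = y k
      & forall j w, j != i -> P j = w *m N -> singular_at g w].
Proof.
move=> sep /row_freeP[N' NN'] Piu eul.
pose Y := N' *m \col_k y k.
have NY k : \sum_l N k l * Y l ord0 = y k.
  have := mulmxA N N' (\col_k y k); rewrite NN' mul1mx => /matrixP/(_ k ord0).
  by rewrite !mxE.
have [|f [hf fc fy fs]] := sep i c (fun k => Y k ord0).
  rewrite Piu -eul; under eq_bigr => k _ do rewrite mxE mulr_suml.
  rewrite exchange_big; apply: eq_bigr => k _ /=.
  rewrite -NY mulr_sumr; apply: eq_bigr => l _; exact: esym (mulrA _ _ _).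
exists (lin_subst N f); split.
- exact: lin_subst_dhomog.
- by rewrite lin_substE -Piu.
- move=> k; rewrite lin_subst_deriv -Piu -NY; apply: eq_bigr => l _.
  by rewrite fy.
- by move=> j w ji Pj; apply: lin_subst_singular; rewrite -Pj; apply: fs.
Qed.

Lemma separates_jets_unitmx (K : fieldType) (n s t : nat)
    (P : 'I_s -> 'rV[K]_n) (N : 'M[K]_n) :
  N \in unitmx ->
  separates_jets (fun i => P i *m N) t -> separates_jets P t.
Proof.
move=> uN sep i c y eul.
have rN : row_free N by rewrite row_free_unit.
have [g [hg gc gy gs]] := separates_jets_restrict sep rN erefl eul.
by exists g; split=> // j ji; apply: (gs j).
Qed.

(** * Lower bound *)

Lemma meval_delta (K : fieldType) (n d : nat) (f : {mpoly K[n]}) i :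
  f \is d.-homog -> ev f (delta_mx ord0 i : 'rV_n) = f@_(U_(i) *+ d).
Proof.
move=> /dhomogP hf; rewrite mevalE.
have E m : m \in msupp f ->
    \prod_k ((delta_mx ord0 i : 'rV[K]_n) ord0 k) ^+ m k
      = (m == U_(i) *+ d)%MM%:R.
  move=> /hf /= hm; have [->|mN] := eqVneq m (U_(i) *+ d)%MM.
    rewrite big1 // => k _; rewrite mulmnE mnm1E mxE eqxx /= eq_sym.
    by case: eqVneq => _; rewrite ?mul1n ?mul0n ?expr0 ?expr1n.
  have [k ki mk] : exists2 k, k != i & (0 < m k)%N.
    apply/exists_inP; apply: contraNT mN => /exists_inPn mk.
    have m0 k : k != i -> m k = 0%N by move=> /mk; case: (m k).
    apply/eqP/mnmP => k; rewrite mulmnE mnm1E; have [<-|ik] := eqVneq i k.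
      rewrite mul1n -hm mdegE (bigD1 i) //= big1 ?addn0 // => l li; exact: m0.
    by rewrite m0 // eq_sym.
  by rewrite (bigD1 k) //= mxE (negbTE ki) andbF expr0n eqn0Ngt mk mul0r.
rewrite big_seq (eq_bigr (fun m => f@_m * (m == U_(i) *+ d)%MM%:R)); last first.
  by move=> m mf; rewrite E.
rewrite -big_seq; have [Uf|Uf] := boolP ((U_(i) *+ d)%MM \in msupp f).
  rewrite (bigD1_seq (U_(i) *+ d)%MM) //= eqxx mulr1 big1 ?addr0 //.
  by move=> m /negbTE ->; rewrite mulr0.
rewrite (memN_msupp_eq0 Uf) big1_seq // => m /andP[_ mf].
by case: eqVneq => [mE|_]; rewrite ?mulr0 // -mE mf in Uf *.
Qed.

(** The coefficients of x_i^t and of x_i^(t-1) x_j, j <> i, are the value and the j-th partial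
    derivative at e_i; all other monomials of degree t have exponent at most t - 2 in x_i. *)
Lemma singular_delta_msupp (K : fieldType) (n t : nat) (f : {mpoly K[n]}) i m :
  f \is t.-homog -> singular_at f (delta_mx ord0 i) -> m \in msupp f ->
  (m i + 2 <= t)%N.
Proof.
move=> hf [f0 df0] mf; have hm : mdeg m = t by apply: (dhomogP _ _ _ hf).
rewrite leqNgt; apply/negP => lt_t.
have mit : (m i <= t)%N by rewrite -hm mdegE (bigD1 i) //= leq_addr.
have [mi|mi] := eqVneq (m i) t.
  have mE : m = (U_(i) *+ t)%MM.
    apply/mnmP => k; rewrite mulmnE mnm1E; have [<-|ik] := eqVneq i k.
      by rewrite mul1n.
    move: hm; rewrite mdegE (bigD1 i) //= (bigD1 k) ?mi /=; last by rewrite eq_sym.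
    by lia.
  by move: f0 mf; rewrite (meval_delta _ hf) -mE mcoeff_msupp => ->; rewrite eqxx.
have mi1 : m i = t.-1 by lia.
have : mdeg (m - U_(i) *+ t.-1)%MM == 1%N.
  rewrite -(eqn_add2r (mdeg (U_(i) *+ t.-1)%MM)) -mdegD submK.
    by rewrite hm mdegMn mdeg1; lia.
  apply/mnm_lepP => k; rewrite mulmnE mnm1E; case: eqVneq => [<-|_] //.
  by rewrite mul1n mi1.
case/mdeg1P => j /eqP jE.
have mE : m = (U_(i) *+ t.-1 + U_(j))%MM.
  rewrite -jE addmC submK //; apply/mnm_lepP => k; rewrite mulmnE mnm1E.
  by case: eqVneq => [<-|_] //; rewrite mul1n mi1.
have ij : i != j.
  apply: contraNneq mi => ij; move/(congr1 (fun m : 'X_{1..n} => m i)): mE.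
  by rewrite mnmDE mulmnE !mnm1E -ij eqxx; lia.
have := df0 j; rewrite (meval_delta _ (dhomog_mderiv j hf)) mcoeff_deriv -mE.
rewrite mulmnE mnm1E (negbTE ij) mul0n mulr1n => m0.
by move: mf; rewrite mcoeff_msupp m0 eqxx.
Qed.

(** On x^m the operator e - x_i d/dx_i is multiplication by the complementary exponent e - m_i; the
    bound on the exponents makes the truncated subtraction exact. *)
Lemma weighted_euler (K : fieldType) (n e : nat) (f : {mpoly K[n]})
    (a : 'I_n -> K) (p : 'rV[K]_n) :
  (forall m i, m \in msupp f -> m i <= e)%N ->
  \sum_i a i * (e%:R * ev f p - p ord0 i * dv i f p) =
  \sum_(m <- msupp f) f@_m *
    (ev 'X_[m] p * \sum_i a i * (e - m i)%:R).
Proof.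
move=> me.
have dE i : p ord0 i * dv i f p =
    \sum_(m <- msupp f) f@_m * (ev 'X_[m] p * (m i)%:R).
  rewrite {1}(mpolyE f) (raddf_sum (mderiv i)) (raddf_sum (meval _)) /= mulr_sumr.
  apply: eq_bigr => m _; rewrite mderivZ mevalZ mulrCA; congr (_ * _).
  rewrite mderivX mevalZ; have [->|mi] := posnP (m i).
    by rewrite mul0r !mulr0.
  rewrite mulrCA [RHS]mulrC; congr (_ * _); rewrite -[X in X * _]mevalXU -mevalM -mpolyXD.
  by congr (ev 'X_[_] p); rewrite addmC submK //; apply/mnm_lepP => k;
     rewrite mnm1E; case: eqVneq => [<-|].
have fE : ev f p = \sum_(m <- msupp f) f@_m * ev 'X_[m] p.
  by rewrite mevalE; apply: eq_bigr => m _; rewrite mevalX.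
rewrite fE; under eq_bigr => i _ do rewrite dE mulr_sumr -sumrB mulr_sumr.
rewrite exchange_big; apply: eq_big_seq => m mf /=.
move: (ev _ p) => X; rewrite !mulr_sumr; apply: eq_bigr => i _.
by rewrite natrB ?me //; ring.
Qed.

(** * Jet relations for forms with bounded exponents *)

Section TestForms.
Variables (K : fieldType) (r e : nat) (f : {mpoly K[r]}) (u v : 'rV[K]_r).
Hypothesis fhom : f \is (e + 2).-homog.
Hypothesis fe : forall m i, m \in msupp f -> (m i <= e)%N.
Variables (i k : 'I_r).
Hypothesis ik : i != k.
Hypothesis fu : ev f u = 0.
Hypothesis fui : u ord0 i * dv i f u = 1.
Hypothesis fuk : u ord0 k * dv k f u = -1.
Hypothesis ful : forall l, l != i -> l != k -> dv l f u = 0.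

(** The complementary exponents add up to r e - (e + 2), the degree of the binary form obtained on
    the rational normal curve. *)
Let codeg m : m \in msupp f -> (\sum_j (e - m j) + (e + 2) = r * e)%N.
Proof.
move=> mf; have <- : mdeg m = (e + 2)%N by apply: (dhomogP _ _ _ fhom).
rewrite mdegE -big_split /= (eq_bigr (fun=> e)) ?sum_nat_const ?card_ord //.
by move=> j _; rewrite subnK // fe.
Qed.

(** The jet prescribed at u is the logarithmic differential of x_i / x_k, so only the weights at i
    and k survive. *)
Let weighted_test a :
  \sum_j a j * (e%:R * ev f u - u ord0 j * dv j f u) = a k - a i.
Proof.
rewrite fu (bigD1 i) //= (bigD1 k) ?[k == i]eq_sym //= fui fuk big1 => [|l].
  ring.
by case/andP=> li lk; rewrite ful // !mulr0 subr0 mulr0.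
Qed.

(** Complementary degree zero: all exponents equal e, so every weighted sum vanishes, while the
    weight concentrated at i must give -1. *)
Lemma no_test_form0 : (r * e <= e + 2)%N -> False.
Proof.
move=> re; have := weighted_test (fun l => (l == i)%:R).
rewrite weighted_euler // big1_seq => [/eqP|m /andP[_ mf]].
  by rewrite eqxx [k == i]eq_sym (negbTE ik) sub0r eq_sym oppr_eq0 oner_eq0.
rewrite [X in _ * (_ * X)]big1 ?mulr0 // => l _.
suff -> : (e - m l)%N = 0%N by rewrite mulr0.
have : (e - m l <= \sum_j (e - m j))%N by rewrite (bigD1 l) //= leq_addr.
by have := codeg mf; lia.
Qed.

Hypothesis fv : singular_at f v.

(** Complementary degree one: a monomial of f is determined by the index l where its exponent is e -
    1. The weight concentrated at l isolates its coefficient, which vanishes because f is singular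
    at v and v has no zero coordinate. *)
Lemma no_test_form1 : (forall l, v ord0 l != 0) -> (r * e = e + 3)%N -> False.
Proof.
move=> v0 re; suff f0 : f = 0.
  by move: fui; rewrite f0 mderiv0 meval0 mulr0 => /esym/eqP; rewrite oner_eq0.
apply/eqP; rewrite -msupp_eq0; case E: (msupp f) => [//|m s].
have mf : m \in msupp f by rewrite E mem_head.
have cod1 m' : m' \in msupp f -> exists l, forall j, (e - m' j)%N = (j == l).
  move=> mf'; have := codeg mf'; rewrite re => cod.
  pose b := [multinom (e - m' j)%N | j < r].
  have : mdeg b == 1%N.
    by rewrite mdegE; under eq_bigr => j _ do rewrite mnmE; lia.
  case/mdeg1P => l /eqP bE; exists l => j.
  by rewrite -(mnmE (fun j => (e - m' j)%N) j) -/b bE mnm1E eq_sym.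
have [l ml] := cod1 m mf.
have := @weighted_euler K r e f (fun j => (j == l)%:R) v fe.
case: fv => -> dv0; rewrite big1 => [|j _]; last by rewrite dv0 !mulr0 subr0 mulr0.
rewrite (bigD1_seq m) //= [X in _ + X]big1_seq => [|m' /andP[m'm mf']].
  rewrite addr0 (bigD1 l) //= big1 => [|j jl]; last by rewrite (negbTE jl) mul0r.
  rewrite ml !eqxx !mulr1 addr0 mulr1 mevalX => /esym/eqP.
  rewrite mulf_eq0 -[_@_ _ == 0]negbK -mcoeff_msupp mf /= prodf_seq_eq0 => /hasP[j _].
  by rewrite expf_eq0 (negbTE (v0 j)) andbF.
have [l' ml'] := cod1 m' mf'.
rewrite (bigD1 l) //= big1 => [|j jl]; last by rewrite (negbTE jl) mul0r.
rewrite eqxx ml'; case: eqVneq => [ll'|_]; last by rewrite mulr0 addr0 !mulr0.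
case/eqP: m'm; apply/mnmP => j; have := ml j; have := ml' j; rewrite ll'.
by have := fe j mf; have := fe j mf'; lia.
Qed.

(* Up to the factor [\prod_l z_l ^ e], the weight [W z j] is [1 / z_j]; it also
   makes sense when coordinates of [z] vanish. *)
Let W (z : 'rV[K]_r) j := \prod_l z ord0 l ^+ (e - (l == j)).

(** Splitting b^m off the weight leaves the derivative of the complementary monomial at b in the
    direction a. When this monomial is quadratic, that is its polarization, symmetric in a and b. *)
Let weighted_sym (a b : 'rV[K]_r) : (r * e = e + 4)%N ->
  \sum_j (a ord0 j * W b j) * (e%:R * ev f a - a ord0 j * dv j f a) =
  \sum_(m <- msupp f) f@_m * (ev 'X_[m] a * ev 'X_[m] b *
    \sum_j a ord0 j * dv j 'X_[[multinom (e - m j)%N | j < r]] b).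
Proof.
move=> re; rewrite weighted_euler //; apply: eq_big_seq => m mf.
rewrite -mulrA; congr (_ * (_ * _)); rewrite mulr_sumr; apply: eq_bigr => j _.
rewrite mderivX mevalZ mnmE; case: (posnP (e - m j)) => [->|mj].
  by rewrite mul0r !mulr0.
rewrite -mulrA [RHS]mulrCA; congr (_ * _); rewrite [RHS]mulrCA [LHS]mulrC; congr (_ * _).
rewrite !mevalX -big_split; apply: eq_bigr => l _ /=.
rewrite -exprD mnmBE mnmE mnm1E eq_sym; congr (_ ^+ _).
by have := fe l mf; case: eqVneq mj => [->|_]; lia.
Qed.

(** By symmetry the weighted sum at u equals the one at v, which vanishes as f is singular there.
    The sum at u is u_k v_i - u_i v_k times (v_i v_k)^(e-1) times powers of the other v_l; all
    factors are nonzero, the second one also when e = 1. *)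
Lemma no_test_form2 : (r * e = e + 4)%N ->
  u ord0 i * v ord0 k != u ord0 k * v ord0 i ->
  (forall l, l != i -> l != k -> v ord0 l != 0) ->
  e = 1%N \/ v ord0 i != 0 /\ v ord0 k != 0 -> False.
Proof.
move=> re uv v0 ev0.
have: \sum_j (u ord0 j * W v j) * (e%:R * ev f u - u ord0 j * dv j f u) =
      \sum_j (v ord0 j * W u j) * (e%:R * ev f v - v ord0 j * dv j f v).
  rewrite !weighted_sym //; apply: eq_big_seq => m mf.
  rewrite [ev _ v * _]mulrC; congr (_ * (_ * _)).
  set b := [multinom _ | j < r].
  have : mdeg b = 2.
    rewrite mdegE; under eq_bigr => j _ do rewrite mnmE.
    by have := codeg mf; lia.
  move=> b2.
  have [p bp] : exists p, (0 < b p)%N.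
    apply/existsP; apply: contraPT b2 => /existsPn b0; rewrite mdegE big1 // => p _.
    by have := b0 p; case: (b p).
  have Ub : (U_(p) <= b)%MM.
    by apply/mnm_lepP => l; rewrite mnm1E; case: eqVneq => [<-|].
  have /mdeg1P [q /eqP bq] : mdeg (b - U_(p))%MM == 1%N.
    by rewrite -(eqn_add2r (mdeg U_(p)%MM)) -mdegD submK // b2 mdeg1.
  have -> : b = (U_(q) + U_(p))%MM by rewrite -bq submK.
  have dX2 (x z : 'rV[K]_r) : \sum_j x ord0 j * dv j 'X_[U_(q) + U_(p)] z =
      x ord0 q * z ord0 p + z ord0 q * x ord0 p.
    rewrite mpolyXD.
    under eq_bigr => j _ do rewrite mderivM mevalD !mevalM !mevalXU !meval_mderivXU mulrDr.
    rewrite big_split /= (bigD1 q) //= [X in _ + X](bigD1 p) //= !eqxx.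
    rewrite !big1 => [|j /negbTE ->|j /negbTE ->]; rewrite ?(mul0r, mulr0) //.
    by rewrite !mul1r !mulr1 !addr0 [x ord0 p * _]mulrC.
  by rewrite !dX2; ring.
rewrite weighted_test [RHS]big1 => [/eqP|j _]; last first.
  by case: fv => -> ->; rewrite !mulr0 subr0 mulr0.
pose Q := \prod_(l | (l != i) && (l != k)) v ord0 l ^+ e.
have Q0 : Q != 0.
  by apply/prodf_neq0 => l /andP[li lk]; rewrite expf_neq0 // v0.
have WE j : j = i \/ j = k ->
    W v j = v ord0 i ^+ (e - (i == j)) * v ord0 k ^+ (e - (k == j)) * Q.
  move=> jik; rewrite /W (bigD1 i) //= (bigD1 k) ?[k == i]eq_sym //= mulrA.
  congr (_ * _); apply: eq_bigr => l /andP[/negbTE li /negbTE lk].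
  by case: jik => ->; rewrite ?li ?lk subn0.
rewrite !WE; [|by left|by right]; rewrite !eqxx [k == i]eq_sym (negbTE ik) !subn0.
have e0 : (0 < e)%N by lia.
rewrite -(prednK e0) subn1 /= !exprS.
set x := v ord0 i ^+ e.-1; set z := v ord0 k ^+ e.-1.
have C0 : x * z * Q != 0.
  apply: mulf_neq0 => //; rewrite /x /z; case: ev0 => [->|[vi vk]].
    by rewrite !expr0 mulr1 oner_neq0.
  by rewrite mulf_neq0 ?expf_neq0.
rewrite (_ : _ - _ = (u ord0 k * v ord0 i - u ord0 i * v ord0 k) * (x * z * Q)).
  by rewrite mulf_eq0 (negbTE C0) orbF subr_eq0 eq_sym (negbTE uv).
ring.
Qed.

End TestForms.

(** * Frames among the points and restriction to their spans *)

Lemma independent_subfamily (K : fieldType) (n s : nat) (P : 'I_s -> 'rV[K]_n)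
    (S : {set 'I_s}) :
  exists r (sigma : 'I_r -> 'I_s),
    [/\ injective sigma, forall k, sigma k \in S, row_free (\matrix_k P (sigma k))
      & forall i, i \in S -> exists w, P i = w *m \matrix_k P (sigma k)].
Proof.
pose M := \matrix_(a < #|S|) P (enum_val a).
have ME : \matrix_k P (enum_val (maxrankfun M k)) = rowsub (maxrankfun M) M.
  by apply/row_matrixP => k; rewrite rowK row_rowsub rowK.
exists (\rank M), (fun k => enum_val (maxrankfun M k)); split.
- by move=> k l /enum_val_inj /maxrankfun_inj.
- by move=> k; apply: enum_valP.
- rewrite ME; exact: maxrowsub_free.
- move=> i iS; apply/submxP; rewrite ME eq_maxrowsub.
  by rewrite (_ : P i = row (enum_rank_in iS i) M) ?row_sub // rowK enum_rankK_in.
Qed.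

Lemma row_free_rowsub (K : fieldType) (m n r : nat) (f : 'I_m -> 'I_r)
    (N : 'M[K]_(r, n)) : injective f -> row_free N -> row_free (rowsub f N).
Proof.
move=> f_inj /row_freeP[N' NN']; apply/row_freeP.
exists (N' *m (rowsub f 1%:M)^T).
rewrite mulmxA mul_rowsub_mx NN'; apply/matrixP => i j.
rewrite !mxE (bigD1 (f i)) //= !mxE eqxx mul1r big1 ?addr0.
  by rewrite (inj_eq f_inj) eq_sym.
by move=> k ki; rewrite !mxE eq_sym (negbTE ki) mul0r.
Qed.

Definition supp (K : fieldType) (n : nat) (u : 'rV[K]_n) : {set 'I_n} :=
  [set i | u ord0 i != 0].

Section LowerBound.
Variables (K : fieldType) (n s : nat) (P : 'I_s -> 'rV[K]_n.+1).
Hypothesis P_distinct : distinct_points P.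

Let P0 i : P i != 0. Proof. exact: P_distinct.1. Qed.

(** Otherwise all minors with a column k where v is nonzero vanish, u is a multiple of v, and the
    two points coincide. *)
Lemma not_proportional r (N : 'M[K]_(r, n.+1)) a b (u v : 'rV_r) :
  a != b -> P a = u *m N -> P b = v *m N ->
  exists i k, u ord0 i * v ord0 k != u ord0 k * v ord0 i.
Proof.
move=> ab Pa Pb.
have v0 : v != 0 by apply: contraNneq (P0 b) => v0; rewrite Pb v0 mul0mx.
have u0 : u != 0 by apply: contraNneq (P0 a) => u0; rewrite Pa u0 mul0mx.
have /rV0Pn[k vk] := v0.
have [/existsP[i uv]|/existsPn uv] :=
  boolP [exists i, u ord0 i * v ord0 k != u ord0 k * v ord0 i]; first by exists i, k.
have uE : u = (u ord0 k / v ord0 k) *: v.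
  apply/rowP => i; rewrite mxE; have /negPn/eqP := uv i => uvE.
  by rewrite mulrAC -uvE mulfK.
have c0 : u ord0 k / v ord0 k != 0.
  by apply: contraNneq u0 => c0; rewrite uE c0 scale0r.
case/eqP: ab; apply: P_distinct.2; rewrite Pa Pb uE -scalemxAl.
apply/vspaceP => x; apply/vlineP/vlineP => -[c ->].
  by exists (c * (u ord0 k / v ord0 k)); rewrite scalerA.
by exists (c / (u ord0 k / v ord0 k)); rewrite scalerA divfK.
Qed.

Section Frame.
Variables (r : nat) (sigma : 'I_r -> 'I_s).
Let N := \matrix_k P (sigma k).

Lemma supp_gt1 a u i : P a = u *m N -> (forall k, sigma k != a) ->
  exists k, [/\ k != i & u ord0 k != 0].
Proof.
move=> Pa sa.
have Pi : P (sigma i) = delta_mx ord0 i *m N by rewrite -rowE rowK.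
have [k [l]] := not_proportional (sa i) Pi Pa.
rewrite !mxE !eqxx /=; have [->|ki] := eqVneq k i; last first.
  rewrite mul0r; have [_|li] := eqVneq l i; last by rewrite mul0r eqxx.
  by rewrite mul1r eq_sym => uk; exists k.
have [->|li] := eqVneq l i; first by rewrite eqxx.
by rewrite mul1r mul0r => ul; exists l.
Qed.

(** The prescribed jet satisfies Euler's relation with value 0, and singularity at the frame points
    bounds the exponents by (e + 2) - 2. This is the form that the [no_test_form] lemmas exclude. *)
Lemma test_form e a u i k : separates_jets P (e + 2) -> row_free N ->
  P a = u *m N -> (forall l, sigma l != a) ->
  i != k -> u ord0 i != 0 -> u ord0 k != 0 ->
  exists f : {mpoly K[r]},
   [/\ f \is (e + 2).-homog, forall m l, m \in msupp f -> (m l <= e)%N,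
    [/\ ev f u = 0, u ord0 i * dv i f u = 1, u ord0 k * dv k f u = -1
       & forall l, l != i -> l != k -> dv l f u = 0]
    & forall b v, b != a -> P b = v *m N -> singular_at f v].
Proof.
move=> sep Nfree Pa sa ik ui uk.
pose y l := if l == i then (u ord0 i)^-1
            else if l == k then - (u ord0 k)^-1 else 0.
have [|f [hf fu fy fs]] :=
    separates_jets_restrict (c := 0) (y := y) sep Nfree Pa.
  rewrite mulr0 (bigD1 i) //= (bigD1 k) ?[k == i]eq_sym //= big1 => [|l].
    by rewrite /y !eqxx [k == i]eq_sym (negbTE ik) mulrN !divff // addr0 subrr.
  by rewrite /y => /andP[/negbTE -> /negbTE ->]; rewrite mulr0.
exists f; split=> //.
- move=> m l mf; have sl : P (sigma l) = delta_mx ord0 l *m N by rewrite -rowE rowK.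
  have := singular_delta_msupp hf (fs _ _ (sa l) sl) mf; lia.
- split=> //; rewrite ?fy /y ?eqxx ?divff //.
    by rewrite [k == i]eq_sym (negbTE ik) mulrN divff.
  by move=> l /negbTE li /negbTE lk; rewrite fy /y li lk.
Qed.

End Frame.

Lemma restrict_frame r (sigma : 'I_r -> 'I_s) (R : {set 'I_r}) a u :
  P a = u *m (\matrix_k P (sigma k)) -> supp u \subset R ->
  P a = colsub (fun k : 'I_#|R| => enum_val k) u *m \matrix_(k < #|R|) P (sigma (enum_val k)).
Proof.
move=> Pa uR; apply/rowP => j; rewrite Pa !mxE.
rewrite (bigID (fun k => k \in R)) /= [X in _ + X]big1 ?addr0 => [|k kR]; last first.
  have : k \notin supp u by apply: contra kR; apply: (subsetP uR).
  by rewrite inE negbK => /eqP ->; rewrite mul0r.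
rewrite big_enum_val; apply: eq_bigr => k _.
by rewrite !mxE.
Qed.

Lemma row_free_frame r (sigma : 'I_r -> 'I_s) (R : {set 'I_r}) :
  row_free (\matrix_k P (sigma k)) ->
  row_free (\matrix_(k < #|R|) P (sigma (enum_val k))).
Proof.
move=> /(row_free_rowsub (@enum_val_inj _ (mem R))).
by congr (is_true (row_free _)); apply/matrixP => i j; rewrite !mxE.
Qed.


Section Bounds.
Variables (r : nat) (sigma : 'I_r -> 'I_s).
Let N := \matrix_k P (sigma k).
Hypothesis Nfree : row_free N.

(** If the inequality failed, restriction to the span of the frame points in the support of u would
    give a test form of complementary degree zero. *)
Lemma supp_bound e a u : separates_jets P (e + 2) ->
  P a = u *m N -> (forall l, sigma l != a) -> (e + 2 < #|supp u| * e)%N.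
Proof.
move=> sep Pa sa; rewrite ltnNge; apply/negP => ue.
have u0 : u != 0 by apply: contraNneq (P0 a) => u0; rewrite Pa u0 mul0mx.
have /rV0Pn[i ui] := u0.
have iR : i \in supp u by rewrite inE.
have Pa' := restrict_frame Pa (subxx (supp u)).
have sa' k : sigma (enum_val (k : 'I_#|supp u|)) != a by apply: sa.
have u'0 (k : 'I_#|supp u|) :
    colsub (fun k : 'I_#|supp u| => enum_val k) u ord0 k != 0.
  by rewrite mxE; have := enum_valP k; rewrite inE.
have [k [ki uk]] := supp_gt1 (enum_rank_in iR i) Pa' sa'.
have [f [hf fe [fu fuk fui ful] _]] :=
  test_form sep (row_free_frame _ Nfree) Pa' sa' ki (u'0 _) (u'0 _).
exact: (no_test_form0 hf fe ki fu fuk fui ful ue).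
Qed.

(** A zero coordinate of v would give e + 2 < (r - 1) e = 3 by [supp_bound], hence e = 0, against
    the equation for r. So v has full support. *)
Lemma no_separation_of_two1 e a b u v : separates_jets P (e + 2) ->
  (r * e = e + 3)%N -> a != b -> (forall l, sigma l != a) ->
  (forall l, sigma l != b) -> P a = u *m N -> P b = v *m N -> False.
Proof.
move=> sep re ab sa sb Pa Pb.
have vb := supp_bound sep Pb sb.
have v0 l : v ord0 l != 0.
  suff /eqP/setP/(_ l) : supp v == setT by rewrite !inE.
  rewrite eqEcard subsetT cardsT card_ord /= leqNgt; apply/negP => lt_r.
  have := leq_mul2r e #|supp v|.+1 r; rewrite lt_r orbT mulSn.
  by case: (e) vb re => [|?] *; lia.
have u0 : u != 0 by apply: contraNneq (P0 a) => u0; rewrite Pa u0 mul0mx.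
have /rV0Pn[i ui] := u0.
have [k [ki uk]] := supp_gt1 i Pa sa.
have [f [hf fe [fu fuk fui ful] fs]] := test_form sep Nfree Pa sa ki uk ui.
apply: (no_test_form1 hf fe ki fuk _ v0 re).
by apply: (fs b) => //; rewrite eq_sym.
Qed.

(** Here e + 2 < (r - 1) e = 4 and the equation for r force e = 1 and r = 5, and v vanishes only at
    l. For any other k the minor of the columns l and k is then nonzero. *)
Lemma no_separation_of_two_zero e a b u v l : separates_jets P (e + 2) ->
  (r * e = e + 4)%N -> a != b -> (forall l, sigma l != a) ->
  (forall l, sigma l != b) -> P a = u *m N -> P b = v *m N ->
  u ord0 l != 0 -> v ord0 l = 0 -> False.
Proof.
move=> sep re ab sa sb Pa Pb ul vl.
have vb := supp_bound sep Pb sb.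
have ub := supp_bound sep Pa sa.
have vl' : supp v \subset [set~ l].
  by apply/subsetP => k; rewrite !inE; apply: contraNneq => ->; rewrite vl.
have e1 : e = 1%N.
  have := subset_leq_card vl'; rewrite cardsC1 card_ord => le_r.
  have := leq_mul2r e #|supp v|.+1 r.
  have -> : (#|supp v| < r)%N by have := ltn_ord l; lia.
  rewrite orbT mulSn re.
  have e0 : e <> 0%N by move=> e0; move: re; rewrite e0 muln0.
  move: vb; set X := (_ * e)%N; lia.
subst e.
have v0 k : k != l -> v ord0 k != 0.
  move=> kl; suff /eqP/setP/(_ k) : supp v == [set~ l] by rewrite !inE kl.
  rewrite eqEcard vl' cardsC1 card_ord /=.
  rewrite !muln1 in vb re; apply: leq_trans vb; by rewrite re.
have [k [kl uk]] := supp_gt1 l Pa sa.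
have lk : l != k by rewrite eq_sym.
have [f [hf fe [fu ful fuk fuo] fs]] := test_form sep Nfree Pa sa lk ul uk.
have fv : singular_at f v by apply: (fs b) => //; rewrite eq_sym.
apply: (no_test_form2 hf fe lk fu ful fuk fuo fv re).
- by rewrite vl mulr0 mulf_neq0 // v0.
- by move=> j jl _; apply: v0.
- by left.
Qed.

Lemma no_separation_of_two2 e a b u v : separates_jets P (e + 2) ->
  (r * e = e + 4)%N -> a != b -> (forall l, sigma l != a) ->
  (forall l, sigma l != b) -> P a = u *m N -> P b = v *m N ->
  (forall l, (u ord0 l != 0) || (v ord0 l != 0)) -> False.
Proof.
move=> sep re ab sa sb Pa Pb uv0.
have ba : b != a by rewrite eq_sym.
have [/existsP[l /eqP vl]|/existsPn v0] := boolP [exists l, v ord0 l == 0].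
  apply: (no_separation_of_two_zero sep re ab sa sb Pa Pb (l := l)) => //.
  by have := uv0 l; rewrite vl eqxx orbF.
have [/existsP[l /eqP ul]|/existsPn u0] := boolP [exists l, u ord0 l == 0].
  exact: (no_separation_of_two_zero sep re ba sb sa Pb Pa (v0 l) ul).
have [i [k uv]] := not_proportional ab Pa Pb.
have ik : i != k by apply: contraNneq uv => ->.
have [f [hf fe [fu fui fuk fuo] fs]] := test_form sep Nfree Pa sa ik (u0 i) (u0 k).
have fv : singular_at f v by exact: (fs b).
apply: (no_test_form2 hf fe ik fu fui fuk fuo fv re uv) => [l _ _|].
  exact: v0.
by right; split; apply: v0.
Qed.

End Bounds.

End LowerBound.

(** If both vectors vanish at l, [supp_bound] again gives e = 1 and r = 5; discarding the frame
    point l leaves four variables, hence complementary degree one. *)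
Lemma no_separation_of_two (K : fieldType) (n s r e : nat)
    (P : 'I_s -> 'rV[K]_n.+1) (sigma : 'I_r -> 'I_s) a b u v :
  distinct_points P -> row_free (\matrix_k P (sigma k)) ->
  separates_jets P (e + 2) -> (r * e = e + 4)%N -> a != b ->
  (forall l, sigma l != a) -> (forall l, sigma l != b) ->
  P a = u *m \matrix_k P (sigma k) -> P b = v *m \matrix_k P (sigma k) -> False.
Proof.
move=> Pd Nfree sep re ab sa sb Pa Pb.
have [/forallP uv0|] := boolP [forall l, (u ord0 l != 0) || (v ord0 l != 0)].
  exact: (no_separation_of_two2 Pd Nfree sep re ab sa sb Pa Pb uv0).
case/forallPn => l; rewrite negb_or !negbK => /andP[/eqP ul /eqP vl].
have sub (w : 'rV[K]_r) : w ord0 l = 0 -> supp w \subset [set~ l].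
  by move=> wl; apply/subsetP => k; rewrite !inE; apply: contraNneq => ->; rewrite wl.
have vb := supp_bound Pd Nfree sep Pb sb.
have e1 : e = 1%N.
  have := subset_leq_card (sub v vl); rewrite cardsC1 card_ord => le_r.
  have := leq_mul2r e #|supp v|.+1 r.
  have -> : (#|supp v| < r)%N by have := ltn_ord l; lia.
  rewrite orbT mulSn re.
  have e0 : e <> 0%N by move=> e0; move: re; rewrite e0 muln0.
  move: vb; set X := (_ * e)%N; lia.
subst e; have Pa' := restrict_frame Pa (sub _ ul).
have Pb' := restrict_frame Pb (sub _ vl).
apply: (no_separation_of_two1 Pd (row_free_frame _ Nfree) sep _ ab _ _ Pa' Pb').
- by rewrite cardsC1 card_ord !muln1 in re *; rewrite re.
- by move=> k; apply: sa.
- by move=> k; apply: sb.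
Qed.

(** The rows of [N] and the points outside S span everything. For n + 3 points, a subspace spanned
    by r of them thus contains at most r + 2. *)
Lemma card_subset_rank (K : fieldType) (n s r : nat) (P : 'I_s -> 'rV[K]_n.+1)
    (S : {set 'I_s}) (N : 'M[K]_(r, n.+1)) :
  nondegenerate_points P -> (forall i, i \in S -> exists w, P i = w *m N) ->
  (n.+1 + #|S| <= s + r)%N.
Proof.
move=> Psp SN.
pose Q := \matrix_(k < #|~: S|) P (enum_val k).
have PQ i : (P i <= col_mx N Q)%MS.
  rewrite -addsmxE; have [/SN[w ->]|iS] := boolP (i \in S).
    exact: submx_trans (submxMl _ _) (addsmxSl _ _).
  have iS' : i \in ~: S by rewrite inE.
  apply: submx_trans (addsmxSr _ _).
  by rewrite (_ : P i = row (enum_rank_in iS' i) Q) ?row_sub // rowK enum_rankK_in.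
have full : row_full (col_mx N Q).
  rewrite -sub1mx; apply/row_subP => i.
  have: row i 1%:M \in (\sum_(i < s) <[P i]>)%VS by rewrite Psp memvf.
  case/memv_sumP => w wP ->; apply: summx_sub => k _.
  by have /vlineP[c ->] := wP k isT; apply: scalemx_sub.
have := rank_leq_row (col_mx N Q); rewrite (eqP full).
by have := cardsC S; rewrite card_ord; lia.
Qed.

Lemma rank_le_dim (K : fieldType) (n r d : nat) (N : 'M[K]_(r, n))
    (L : {vspace 'rV[K]_n}) :
  row_free N -> (forall k, row k N \in L) -> \dim L = d -> (r <= d)%N.
Proof.
move=> /eqP rN NL <-; rewrite -[X in (X <= _)%N]rN.
pose B := \matrix_(k < \dim L) (vbasis L)`_k.
apply: leq_trans (rank_leq_row B); apply: mxrankS.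
apply/row_subP => k; rewrite (coord_vbasis (NL k)).
apply: summx_sub => l _; apply: scalemx_sub.
by rewrite (_ : (vbasis L)`_l = row l B) ?row_sub // rowK.
Qed.

(** With r the rank of S, the cases are that S has at most r, r + 1 or r + 2 points. Small r need
    their own lower bounds for t; otherwise t >= 3 suffices. *)
Lemma separates_jets_bound (K : fieldType) (n : nat)
    (P : 'I_(n + 3) -> 'rV[K]_n.+1) j t (S : {set 'I_(n + 3)}) :
  distinct_points P -> nondegenerate_points P -> (0 < j)%N ->
  on_linear_subspace P j S -> separates_jets P t ->
  ((2 * #|S| + j - 2) %/ j <= t)%N.
Proof.
move=> Pd Psp j0 [L [dimL SL]] sep; have P0 := Pd.1.
have lt_t d : (separates_jets P d -> False) -> (d < t)%N.
  move=> nsep; rewrite ltnNge; apply/negP => td.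
  by apply: nsep; apply: (separates_jets_leq P0 td).
have tj k : (k <= t)%N -> (k * j + j <= t.+1 * j)%N.
  by move=> kt; rewrite addnC -mulSn leq_mul2r ltnS kt orbT.
have outside r (sigma : 'I_r -> 'I_(n + 3)) (A : {set 'I_(n + 3)}) :
    injective sigma -> (r < #|A|)%N -> exists2 a, a \in A & forall k, sigma k != a.
  move=> sinj rA.
  have /set0Pn[a] : A :\: [set sigma k | k in 'I_r] != set0.
    rewrite setD_eq0; apply: contraTN rA => /subset_leq_card.
    by rewrite card_imset // card_ord leqNgt.
  rewrite inE => /andP[/imsetP sa aA]; exists a => // k.
  by apply/eqP => ska; apply: sa; exists k.
(* In degree 2, that is e = 0, [supp_bound] would read 2 < 0 for a point outside a frame. *)
have t3 : (3 <= t)%N.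
  apply: lt_t => sep2.
  have [r [sigma [sinj _ Nfree span]]] := independent_subfamily P setT.
  have rn : (r <= n.+1)%N.
    by have := rank_leq_col (\matrix_k P (sigma k)); rewrite (eqP Nfree).
  have [|a _ sa] := outside r sigma setT sinj.
    by rewrite cardsT card_ord; lia.
  have [u Pa] := span a (in_setT a).
  have := @supp_bound _ _ _ _ Pd _ _ Nfree 0 a u sep2 Pa sa.
  by rewrite muln0.
have [r [sigma [sinj sS Nfree span]]] := independent_subfamily P S.
have rj : (r <= j.+1)%N.
  apply: (rank_le_dim Nfree _ dimL) => k; rewrite rowK; apply: SL; exact: sS.
have cardS : (#|S| <= r + 2)%N by have := card_subset_rank Psp span; lia.
have [le_r|lt_r] := leqP #|S| r.
  suff : ((2 * #|S| + j - 2) %/ j < 4)%N by lia.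
  by rewrite ltn_divLR //; lia.
have [a aS sa] := outside r sigma S sinj lt_r.
have [u Pa] := span a aS.
have ub e : separates_jets P (e + 2) -> (e + 2 < r * e)%N.
  move=> sepe; apply: (leq_trans (supp_bound Pd Nfree sepe Pa sa)).
  by rewrite leq_mul2r -[X in (_ <= X)%N]card_ord max_card orbT.
have r2 : (2 <= r)%N.
  have u0 : u != 0 by apply: contraNneq (P0 a) => u0; rewrite Pa u0 mul0mx.
  have /rV0Pn[i _] := u0.
  have [k [ki _]] := supp_gt1 Pd i Pa sa.
  by have := ltn_ord i; have := ltn_ord k; move: ki; rewrite -val_eqE /=; lia.
(* With one point outside the frame, separation fails in degree e + 2 when r e <= e + 2: take e = 2
   for r = 2 and e = 1 for r = 3. *)
have r2t : r = 2 -> (5 <= t)%N by move=> r_eq; apply: lt_t => /(ub 2); lia.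
have r3t : r = 3 -> (4 <= t)%N by move=> r_eq; apply: lt_t => /(ub 1); lia.
have [le_r1|lt_r1] := leqP #|S| r.+1.
  rewrite -ltnS ltn_divLR //.
  have [r_eq|r_neq2] := eqVneq r 2; first by have := tj _ (r2t r_eq); lia.
  have [r_eq|r_neq3] := eqVneq r 3; first by have := tj _ (r3t r_eq); lia.
  by have := tj _ t3; lia.
have [b] : exists2 b, b \in S :\ a & forall k, sigma k != b.
  by apply: outside => //; have := cardsD1 a S; rewrite aS; lia.
rewrite !inE => /andP[ba bS] sb.
have [v Pb] := span b bS.
have ab : a != b by rewrite eq_sym.
have two e : (r * e = e + 4)%N -> separates_jets P (e + 2) -> False.
  by move=> re sepe; apply: (no_separation_of_two Pd Nfree sepe re ab sa sb Pa Pb).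
(* With two points outside the frame, (r, e) = (2, 4), (3, 2), (5, 1) have complementary degree two
   and (4, 1) has complementary degree one. *)
have r2t' : r = 2 -> (7 <= t)%N.
  by move=> r_eq; apply: lt_t; apply: (two 4); rewrite r_eq.
have r3t' : r = 3 -> (5 <= t)%N.
  by move=> r_eq; apply: lt_t; apply: (two 2); rewrite r_eq.
have r4t' : r = 4 -> (4 <= t)%N.
  move=> r_eq; apply: lt_t => sep3.
  apply: (no_separation_of_two1 Pd Nfree (e := 1) sep3 _ ab sa sb Pa Pb).
  by rewrite r_eq.
have r5t' : r = 5 -> (4 <= t)%N.
  by move=> r_eq; apply: lt_t; apply: (two 1%N); rewrite r_eq.
rewrite -ltnS ltn_divLR //.
(* For r >= 6 one has j >= 5, so 2 (r + 2) + j - 2 <= 3 j + 4 < 4 j and the quotient is at most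
   3. *)
have [r5|r6] := leqP r 5; last by have := tj _ t3; lia.
have [r_eq|r_neq2] := eqVneq r 2; first by have := tj _ (r2t' r_eq); lia.
have [r_eq|r_neq3] := eqVneq r 3; first by have := tj _ (r3t' r_eq); lia.
have [r_eq|r_neq4] := eqVneq r 4; first by have := tj _ (r4t' r_eq); lia.
have r_eq : r = 5 by lia.
by have := tj _ (r5t' r_eq); lia.
Qed.

(** * Upper bound *)

(** Let c have neighbours p and q and let r be a fourth vertex. If r is adjacent to q or p, take c
    p, q r or c q, p r. Otherwise p and q are not adjacent, so a second neighbour z of p differs
    from q; take c q, p z. *)
Lemma disjoint_edges (T : finType) (E : rel T) (W : {set T}) :
  ssrbool.symmetric E -> irreflexive E ->
  (forall x y z, y \in W -> ~~ E x y -> ~~ E y z -> ~~ E x z) ->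
  (4 <= #|W|)%N -> (forall c, c \in W -> 2 <= #|[set i in W | E c i]|)%N ->
  exists i j k l, [/\ [/\ i \in W, j \in W, k \in W & l \in W], E i j, E k l
    & [/\ i != k, i != l, j != k & j != l]].
Proof.
move=> Es Ei Ent W4 W2.
have Ene x y : E x y -> x != y by move=> Exy; apply: contraTneq Exy => ->; rewrite Ei.
have ne x y : x != y \/ y != x \/ E x y \/ E y x -> x != y.
  by rewrite [y == x]eq_sym; case=> [|[|[/Ene|/Ene]]] //; rewrite eq_sym.
have [c cW] : exists c, c \in W by apply/set0Pn; rewrite -card_gt0; lia.
have [p [q []]] := card_gt1P (W2 c cW).
rewrite !inE => /andP[pW cp] /andP[qW cq] pq.
have : W :\: [set c; p; q] != set0.
  rewrite setD_eq0; apply: contraTN W4 => /subset_leq_card.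
  move=> /leq_trans; rewrite -ltnNge; apply.
  apply: leq_trans (leq_card_setU _ _).1 _; rewrite cards1 cards2.
  by case: (_ != _).
case/set0Pn => r; rewrite !inE !negb_or -!andbA => /and4P[rc rp rq rW].
have [qr|qr] := boolP (E q r).
  by exists c, p, q, r; split=> //; split; apply: ne; tauto.
have [pr|pr] := boolP (E p r).
  by exists c, q, p, r; split=> //; split; apply: ne; tauto.
have pNq : ~~ E p q by apply: (Ent _ r); rewrite // Es.
have [z [zW pz zc]] : exists z, [/\ z \in W, E p z & z != c].
  have [x [y []]] := card_gt1P (W2 p pW); rewrite !inE => /andP[xW px] /andP[yW py] xy.
  have [xc|] := eqVneq x c; last by exists x.
  by exists y; split=> //; rewrite -xc eq_sym.
have qz : q != z by apply: contraNneq pNq => ->.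
by exists c, q, p, z; split=> //; split; apply: ne; tauto.
Qed.

(** * Products of linear forms *)

Section LinearForms.
Variables (K : fieldType) (n : nat).
Implicit Types (w p : 'rV[K]_n).

Definition dot w p : K := \sum_k w ord0 k * p ord0 k.

Definition lin_form w : {mpoly K[n]} := \sum_k w ord0 k *: 'X_k.

Definition prod_forms (ws : seq 'rV[K]_n) := \prod_(w <- ws) lin_form w.

Lemma meval_lin_form w p : ev (lin_form w) p = dot w p.
Proof.
rewrite raddf_sum; apply: eq_bigr => k _ /=; by rewrite mevalZ mevalXU.
Qed.

Lemma mderiv_lin_form w p k : dv k (lin_form w) p = w ord0 k.
Proof.
rewrite (raddf_sum (mderiv k)) (raddf_sum (meval _)) (bigD1 k) //= big1.
  by rewrite addr0 mderivZ mevalZ meval_mderivXU eqxx mulr1.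
by move=> l lk; rewrite mderivZ mevalZ meval_mderivXU eq_sym (negbTE lk) mulr0.
Qed.

Lemma dhomog_lin_form w : lin_form w \is 1.-homog.
Proof. by apply: rpred_sum => k _; rewrite rpredZ // dhomogX /= mdeg1. Qed.

Lemma dhomog_prod_forms ws : prod_forms ws \is (size ws).-homog.
Proof.
rewrite /prod_forms; elim: ws => [|w ws IH]; first by rewrite big_nil dhomog1.
by rewrite big_cons; exact: (dhomogM (dhomog_lin_form w) IH).
Qed.

Lemma meval_prod_forms ws p : ev (prod_forms ws) p = \prod_(w <- ws) dot w p.
Proof.
by rewrite rmorph_prod; apply: eq_bigr => w _; apply: meval_lin_form.
Qed.

Lemma prod_forms_cons w ws : prod_forms (w :: ws) = lin_form w * prod_forms ws.
Proof. exact: big_cons. Qed.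

Lemma mderiv_prod_forms w ws p k : dv k (prod_forms (w :: ws)) p =
  w ord0 k * ev (prod_forms ws) p + dot w p * dv k (prod_forms ws) p.
Proof.
by rewrite prod_forms_cons mderivM mevalD !mevalM mderiv_lin_form meval_lin_form.
Qed.

Lemma singular_prod_forms ws p :
  (1 < count (fun w => dot w p == 0%R) ws)%N -> singular_at (prod_forms ws) p.
Proof.
elim: ws => // w ws IH /=; have [w0|w0] := eqVneq (dot w p) 0.
  rewrite add1n ltnS -has_count => /hasP[w' w'ws /eqP w'0].
  have ws0 : ev (prod_forms ws) p = 0.
    by rewrite meval_prod_forms (big_rem w') //= w'0 mul0r.
  split=> [|k]; first by rewrite prod_forms_cons mevalM ws0 mulr0.
  by rewrite mderiv_prod_forms ws0 w0 mulr0 mul0r addr0.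
rewrite add0n => /IH[ws0 dws0].
split=> [|k]; first by rewrite prod_forms_cons mevalM ws0 mulr0.
by rewrite mderiv_prod_forms ws0 dws0 !mulr0 addr0.
Qed.

Lemma dot_delta w i : dot w (delta_mx ord0 i) = w ord0 i.
Proof.
rewrite /dot (bigD1 i) //= mxE !eqxx mulr1 big1 ?addr0 // => k /negbTE ki.
by rewrite mxE ki andbF mulr0.
Qed.

Lemma dotC w p : dot w p = dot p w.
Proof. by apply: eq_bigr => k _; rewrite mulrC. Qed.

Lemma dotBl w w' p : dot (w - w') p = dot w p - dot w' p.
Proof. by rewrite /dot -sumrB; apply: eq_bigr => k _; rewrite !mxE mulrBl. Qed.

Lemma dotZl c w p : dot (c *: w) p = c * dot w p.
Proof. by rewrite /dot mulr_sumr; apply: eq_bigr => k _; rewrite !mxE mulrA. Qed.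

(** Coefficients of p_j x_i - p_i x_j, which vanishes at p and at every coordinate point other than
    e_i and e_j. *)
Definition pair_form (p : 'rV[K]_n) i j : 'rV[K]_n :=
  p ord0 j *: delta_mx ord0 i - p ord0 i *: delta_mx ord0 j.

Lemma dot_pair_form p q i j :
  dot (pair_form p i j) q = p ord0 j * q ord0 i - p ord0 i * q ord0 j.
Proof. by rewrite dotBl !dotZl !(dotC (delta_mx _ _)) !dot_delta. Qed.

Lemma pair_formE p i j k : pair_form p i j ord0 k =
  p ord0 j * (k == i)%:R - p ord0 i * (k == j)%:R.
Proof. by rewrite !mxE eqxx. Qed.

Lemma pair_form_out p i j k : k != i -> k != j -> pair_form p i j ord0 k = 0.
Proof. by move=> /negbTE ki /negbTE kj; rewrite pair_formE ki kj !mulr0 subr0. Qed.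

End LinearForms.

(** * Jets at u of forms singular at v and at the coordinate points *)

Definition avoiding_form (K : fieldType) (n t : nat) (v : 'rV[K]_n)
    (f : {mpoly K[n]}) : Prop :=
  [/\ f \is t.-homog, forall l, singular_at f (delta_mx ord0 l : 'rV_n)
    & singular_at f v].

Definition solvable_jets (K : fieldType) (n t : nat) (u v : 'rV[K]_n) : Prop :=
  forall c (y : 'I_n -> K), \sum_k u ord0 k * y k = t%:R * c ->
  exists f, [/\ avoiding_form t v f, ev f u = c & forall k, dv k f u = y k].

Lemma singular_atD (K : fieldType) (n : nat) (f g : {mpoly K[n]}) (p : 'rV_n) :
  singular_at f p -> singular_at g p -> singular_at (f + g) p.
Proof.
move=> [f0 df0] [g0 dg0]; split=> [|k]; first by rewrite mevalD f0 g0 addr0.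
by rewrite mderivD mevalD df0 dg0 addr0.
Qed.

Lemma singular_atZ (K : fieldType) (n : nat) c (f : {mpoly K[n]}) (p : 'rV_n) :
  singular_at f p -> singular_at (c *: f) p.
Proof.
move=> [f0 df0]; split=> [|k]; first by rewrite mevalZ f0 mulr0.
by rewrite mderivZ mevalZ df0 mulr0.
Qed.

Lemma singular_at0 (K : fieldType) (n : nat) (p : 'rV[K]_n) : singular_at 0 p.
Proof. by split=> [|k]; rewrite ?mderiv0 meval0. Qed.

Section Solvable.
Variables (K : fieldType) (n : nat) (u v : 'rV[K]_n).

Section Degree.
Variable t : nat.

Lemma avoiding_form0 : avoiding_form t v 0.
Proof.
split; [exact: dhomog0 | by move=> l; apply: singular_at0 | exact: singular_at0].
Qed.

Lemma avoiding_formD f g :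
  avoiding_form t v f -> avoiding_form t v g -> avoiding_form t v (f + g).
Proof.
move=> [hf fs fv] [hg gs gv]; split; first exact: dhomogD.
  by move=> l; apply: singular_atD.
exact: singular_atD.
Qed.

Lemma avoiding_formZ c f : avoiding_form t v f -> avoiding_form t v (c *: f).
Proof.
move=> [hf fs fv]; split; first exact: dhomogZ.
  by move=> l; apply: singular_atZ.
exact: singular_atZ.
Qed.

Lemma avoiding_prod_forms ws : size ws = t ->
  (forall l, 1 < count (fun w : 'rV[K]_n => w ord0 l == 0%R) ws)%N ->
  (1 < count (fun w => dot w v == 0%R) ws)%N ->
  avoiding_form t v (prod_forms ws).
Proof.
move=> <- ws0 wsv; split; first exact: dhomog_prod_forms.
  move=> l; apply: singular_prod_forms.
  rewrite (eq_count (a2 := fun w : 'rV[K]_n => w ord0 l == 0)) // => w.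
  by rewrite dot_delta.
exact: singular_prod_forms.
Qed.

(* The differentials of the forms [pair_form u k r] span the cotangent space of
   projective space at [u]. *)
Definition conormal_pair k r : Prop :=
  exists f, [/\ avoiding_form t v f, ev f u = 0
              & forall l, dv l f u = pair_form u k r ord0 l].

(** From u_l (u_r x_k - u_k x_r) = u_r (u_l x_k - u_k x_l) + u_k (u_r x_l - u_l x_r). *)
Lemma conormal_pair_trans k l r : u ord0 l != 0 ->
  conormal_pair k l -> conormal_pair l r -> conormal_pair k r.
Proof.
move=> ul [f [fa f0 df]] [g [ga g0 dg]].
exists ((u ord0 l)^-1 *: (u ord0 r *: f + u ord0 k *: g)); split.
- by apply: avoiding_formZ; apply: avoiding_formD; apply: avoiding_formZ.
- by rewrite !(mevalZ, mevalD) f0 g0 !mulr0 addr0 mulr0.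
- move=> m; rewrite !(mderivZ, mderivD) !(mevalZ, mevalD) df dg !pair_formE.
  move: (_ == _)%:R (_ == _)%:R (_ == _)%:R => a b c; by field.
Qed.

(** A multiple of [f0] fixes the value. Apart from the r-th partial derivative, the form for (k, r)
    changes only the k-th one, by u_r; the r-th follows from Euler's formula. *)
Lemma solvable_of_conormal_pairs r f0 : u ord0 r != 0 ->
  avoiding_form t v f0 -> ev f0 u != 0 ->
  (forall k, k != r -> conormal_pair k r) -> solvable_jets t u v.
Proof.
move=> ur f0a f0u pairs c y eul.
have /choice [F FP] : forall k, exists f, [/\ avoiding_form t v f, ev f u = 0
    & k != r -> forall l, dv l f u = pair_form u k r ord0 l].
  move=> k; have [->|/pairs [f [fa fu df]]] := eqVneq k r; last by exists f.
  by exists 0; split; [exact: avoiding_form0 | rewrite meval0 |].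
pose d := c / ev f0 u.
pose z k := (y k - d * dv k f0 u) / u ord0 r.
pose f := d *: f0 + \sum_(k | k != r) z k *: F k.
have fa : avoiding_form t v f.
  apply: avoiding_formD; first exact: avoiding_formZ.
  elim/big_rec: _ => [|k g _ ga]; first exact: avoiding_form0.
  by apply: avoiding_formD => //; apply: avoiding_formZ; case: (FP k).
have fu : ev f u = c.
  rewrite mevalD mevalZ divfK // (raddf_sum (meval _)) big1 ?addr0 // => k _ /=.
  by case: (FP k) => _ Fu _; rewrite mevalZ Fu mulr0.
exists f; split=> //; apply: (euler_jet_eq ur); last first.
  by case: fa => hf _ _; rewrite (euler _ hf) fu.
move=> l lr; rewrite mderivD mevalD mderivZ mevalZ.
have -> : dv l (\sum_(k | k != r) z k *: F k) u = \sum_(k | k != r) z k * dv l (F k) u.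
  rewrite (raddf_sum (mderiv l)) (raddf_sum (meval _)).
  by apply: eq_bigr => k _ /=; rewrite mderivZ mevalZ.
rewrite (bigD1 l) //= big1 ?addr0 => [|k /andP[kr kl]].
  case: (FP l) => _ _ dF; rewrite dF // pair_formE eqxx (negbTE lr).
  by rewrite mulr1 mulr0 subr0 divfK // addrC subrK.
case: (FP k) => _ _ dF; rewrite dF // pair_form_out ?mulr0 //.
by rewrite eq_sym.
Qed.

(** As [pair_form u k r] vanishes at u, the differential of the whole product there is this form
    times the value of the other factors. *)
Lemma conormal_pair_prod k r ws : (size ws).+1 = t ->
  \prod_(w <- ws) dot w u != 0 ->
  (forall l, 1 < (pair_form u k r ord0 l == 0%R)
               + count (fun w : 'rV[K]_n => w ord0 l == 0%R) ws)%N ->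
  (1 < count (fun w => dot w v == 0%R) ws)%N ->
  conormal_pair k r.
Proof.
move=> wst wsu wsl wsv.
exists ((\prod_(w <- ws) dot w u)^-1 *: prod_forms (pair_form u k r :: ws)).
have u0 : dot (pair_form u k r) u = 0 by rewrite dot_pair_form mulrC subrr.
split.
- apply: avoiding_formZ; apply: avoiding_prod_forms => //=.
  by rewrite (leq_trans wsv) // leq_addl.
- by rewrite mevalZ meval_prod_forms big_cons u0 mul0r mulr0.
- move=> l; rewrite mderivZ mevalZ mderiv_prod_forms u0 mul0r addr0.
  by rewrite meval_prod_forms mulrC mulfK.
Qed.

(** The product of [ws] is already singular at all points to be avoided, so one more factor is free:
    a coordinate for the value, [pair_form u k r] for the conormal directions. *)
Lemma solvable_of_cofactor ws : u != 0 -> (size ws).+1 = t ->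
  \prod_(w <- ws) dot w u != 0 ->
  (forall l, 1 < count (fun w : 'rV[K]_n => w ord0 l == 0%R) ws)%N ->
  (1 < count (fun w => dot w v == 0%R) ws)%N ->
  solvable_jets t u v.
Proof.
move=> /rV0Pn[r ur] wst wsu wsl wsv.
apply: (@solvable_of_conormal_pairs r (prod_forms (delta_mx ord0 r :: ws))) => //.
- apply: avoiding_prod_forms => // [l|] /=.
    by rewrite (leq_trans (wsl l)) // leq_addl.
  by rewrite (leq_trans wsv) // leq_addl.
- by rewrite meval_prod_forms big_cons dotC dot_delta mulf_neq0.
- move=> k kr; apply: (conormal_pair_prod wst) => // l.
  by rewrite (leq_trans (wsl l)) // leq_addl.
Qed.

End Degree.

Definition bracket i j : bool := u ord0 i * v ord0 j != u ord0 j * v ord0 i.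

Let M := supp u :|: supp v.

Lemma bracketC : ssrbool.symmetric bracket.
Proof. by move=> i j; rewrite /bracket eq_sym. Qed.

Lemma bracketxx : irreflexive bracket.
Proof. by move=> i; rewrite /bracket eqxx. Qed.

Lemma bracket_supp i j : bracket i j -> i \in M.
Proof.
rewrite !inE; apply: contraR; rewrite negb_or !negbK => /andP[/eqP ui /eqP vi].
by rewrite /bracket ui vi mul0r mulr0 eqxx.
Qed.

(** The brackets are the minors of the matrix with rows u and v; its column j is nonzero, and the
    columns i and k are multiples of it. *)
Lemma bracketN_trans i j k :
  j \in M -> ~~ bracket i j -> ~~ bracket j k -> ~~ bracket i k.
Proof.
rewrite !inE /bracket !negbK => jM /eqP ij /eqP jk.
have [uj|uj] := eqVneq (u ord0 j) 0.
  move: jM ij jk; rewrite uj eqxx /= => vj /eqP.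
  rewrite mul0r mulf_eq0 (negbTE vj) orbF => /eqP -> /esym/eqP.
  by rewrite mul0r mulf_eq0 (negbTE vj) orbF => /eqP ->; rewrite !mul0r.
rewrite -(inj_eq (mulfI uj)); apply/eqP.
by rewrite mulrCA jk mulrCA ij mulrCA.
Qed.

Lemma dot_bracket i j : bracket i j -> dot (pair_form v i j) u != 0.
Proof. by rewrite dot_pair_form subr_eq0 mulrC [v _ _ * _]mulrC. Qed.

Lemma dot_pair_form_self i j : dot (pair_form v i j) v = 0.
Proof. by rewrite dot_pair_form mulrC subrr. Qed.

Lemma dot_supp p : p \in supp u -> dot (delta_mx ord0 p) u != 0.
Proof. by rewrite inE dotC dot_delta. Qed.

Lemma pair_delta_out (w : 'rV[K]_n) i j p l : p != i -> p != j ->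
  (pair_form w i j ord0 l == 0) ||
  ((delta_mx ord0 p : 'rV[K]_n) ord0 l == 0).
Proof.
move=> pi pj; rewrite [(delta_mx _ _) _ _]mxE; have [->|_] := eqVneq l p.
  by rewrite pair_form_out // eqxx.
by rewrite andbF eqxx orbT.
Qed.

Lemma pair_pair_out (w w' : 'rV[K]_n) i j k m l :
  i != k -> i != m -> j != k -> j != m ->
  (pair_form w i j ord0 l == 0) || (pair_form w' k m ord0 l == 0).
Proof.
move=> ik im jk jm; have [->|li] := eqVneq l i.
  by rewrite orbC pair_form_out // eqxx.
have [->|lj] := eqVneq l j; first by rewrite orbC pair_form_out // eqxx.
by rewrite pair_form_out ?eqxx.
Qed.

Lemma delta_delta_out p q l : p != q ->
  ((delta_mx ord0 p : 'rV[K]_n) ord0 l == 0) ||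
  ((delta_mx ord0 q : 'rV[K]_n) ord0 l == 0).
Proof.
move=> pq; rewrite !mxE eqxx /=; have [->|_] := eqVneq l p.
  by rewrite (negbTE pq) eqxx orbT.
by rewrite eqxx.
Qed.

End Solvable.

(** * The products in degrees 7, 5, 4 and 3 *)

Section SolvableDegrees.
Variables (K : fieldType) (n : nat) (u v : 'rV[K]_n).
Local Notation E := (bracket u v).
Let M := supp u :|: supp v.
Let A := supp u.
Let e (p : 'I_n) : 'rV[K]_n := delta_mx ord0 p.

Let u0 : (0 < #|A|)%N -> u != 0.
Proof.
rewrite card_gt0 => /set0Pn[p]; rewrite inE => up.
by apply: contraNneq up => ->; rewrite mxE.
Qed.

Let card_setD1_ge (s : 'I_n) (S : {set 'I_n}) m : (m < #|S| -> m <= #|S :\ s|)%N.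
Proof. by rewrite (cardsD1 s); case: (s \in S) => // /ltnW. Qed.

Let count2 (b1 b2 b3 b4 : bool) :
  (b1 || b2) && (b3 || b4) || b3 && b4 -> (1 < b1 + (b2 + (b3 + (b4 + 0))))%N.
Proof. by case: b1 b2 b3 b4 => [] [] [] []. Qed.

(** The cofactor is the square of L_ij x_p x_q, where L_ij = v_j x_i - v_i x_j vanishes at v, and at
    each coordinate point x_p or x_q does. *)
Lemma solvable_jets7 i j : E i j -> (2 <= #|A|)%N -> solvable_jets 7 u v.
Proof.
move=> ij A2; have [p [q [pA qA pq]]] := card_gt1P A2.
pose ws := [:: pair_form v i j; pair_form v i j; e p; e p; e q; e q].
apply: (@solvable_of_cofactor _ _ _ _ _ ws).
- by apply: u0; apply: ltnW.
- by [].
- by rewrite /ws !big_cons big_nil !mulf_neq0 ?oner_neq0 ?dot_bracket ?dot_supp.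
- move=> l; have := delta_delta_out K l pq; rewrite /ws /=.
  by case: (_ == _) (_ == _) (_ == _) => [] [] [].
- by rewrite /= dot_pair_form_self eqxx.
Qed.

(** If A has at least three elements, every y is admissible, and a third index of M has a nonzero
    bracket with i or j. Otherwise some y in M has u_y = 0, and its bracket with each element of A
    is nonzero. *)
Lemma bracket_path i j : E i j -> (3 <= #|M|)%N -> (2 <= #|A|)%N ->
  exists x y z, [/\ E x y, E y z, x != z & (2 <= #|A :\ y|)%N].
Proof.
move=> ij M3 A2.
have Es := bracketC u v; have Ei := bracketxx u v.
have Ene x y : E x y -> x != y by move=> Exy; apply: contraTneq Exy => ->; rewrite Ei.
have [A3|A3] := leqP 3 #|A|.
  have Ay y : (2 <= #|A :\ y|)%N by apply: card_setD1_ge.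
  have : M :\: [set i; j] != set0.
    rewrite setD_eq0; apply: contraTN M3 => /subset_leq_card.
    by rewrite cards2 Ene // -ltnNge.
  case/set0Pn => z; rewrite !inE !negb_or -andbA => /and3P[zi zj zM].
  have [iz|iz] := boolP (E i z).
    by exists j, i, z; split; rewrite // 1?Es // eq_sym.
  exists i, j, z; split; rewrite // 1?eq_sym //.
  apply: contraLR ij => jz; apply: (bracketN_trans _ iz); last by rewrite Es.
  by rewrite !inE.
have : M :\: A != set0.
  rewrite setD_eq0; apply: contraTN M3 => /subset_leq_card; lia.
case/set0Pn => y; rewrite !inE negbK => /andP[/eqP uy]; rewrite uy eqxx /= => vy.
have Ey p : p \in A -> E y p.
  by rewrite inE => up; rewrite /bracket uy mul0r eq_sym mulf_eq0 (negbTE vy) orbF.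
have [p [q [pA qA pq]]] := card_gt1P A2.
exists p, y, q; split=> //; [by rewrite Es Ey | exact: Ey |].
by rewrite (_ : A :\ y = A) //; apply/setDidPl; rewrite disjoint_sym disjoints1 inE uy eqxx.
Qed.

(** The cofactor is L_xy L_yz x_p x_q with p, q different from y. At e_y both coordinates vanish; at
    any other e_l one coordinate and one of the L do, as these share only the variable x_y. *)
Lemma solvable_jets5 i j : E i j -> (3 <= #|M|)%N -> (2 <= #|A|)%N ->
  solvable_jets 5 u v.
Proof.
move=> ij M3 A2; have [x [y [z [xy yz xz Ay]]]] := bracket_path ij M3 A2.
have [p [q []]] := card_gt1P Ay.
rewrite !in_setD1 => /andP[py pA] /andP[qy qA] pq.
pose ws := [:: pair_form v x y; pair_form v y z; e p; e q].
apply: (@solvable_of_cofactor _ _ _ _ _ ws).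
- by apply: u0; apply: ltnW.
- by [].
- by rewrite /ws !big_cons big_nil !mulf_neq0 ?oner_neq0 ?dot_bracket ?dot_supp.
- move=> l /=; have [ly|ly] := eqVneq l y.
    have e0 w : w != y -> e w ord0 y == 0.
      by move=> wy; rewrite mxE [y == w]eq_sym (negbTE wy) andbF.
    by apply: count2; rewrite ly !e0 ?orbT.
  apply: count2; rewrite delta_delta_out // andbT; apply/orP; left.
  have [lx|lx] := eqVneq l x; last by rewrite pair_form_out ?eqxx.
  by rewrite orbC pair_form_out ?eqxx // lx.
- by rewrite /= !dot_pair_form_self eqxx.
Qed.

Let disjoint_brackets (W : {set 'I_n}) : W \subset M -> (4 <= #|W|)%N ->
  (forall c, c \in W -> 2 <= #|[set i in W | E c i]|)%N ->
  exists i j k l, [/\ [/\ i \in W, j \in W, k \in W & l \in W], E i j, E k l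
    & [/\ i != k, i != l, j != k & j != l]].
Proof.
move=> WM; apply: disjoint_edges; [exact: bracketC | exact: bracketxx |].
by move=> x y z /(subsetP WM); apply: bracketN_trans.
Qed.

Let bracket_sub c : [set i in M | E c i] = [set i | E c i].
Proof.
apply/setP => i; rewrite [LHS]inE [RHS]inE; case ci: (E c i); rewrite ?andbF //.
by rewrite andbT; apply: (@bracket_supp _ _ _ _ i c); rewrite bracketC.
Qed.

(** For disjoint brackets, L_ij L_kl has two factors vanishing at v and at least one at each
    coordinate point. The second zero there comes from x_q x_r for the value, and from
    [pair_form u s r] times x_p with p outside {s, r} for the differentials. *)
Lemma solvable_jets4 : (4 <= #|M|)%N -> (3 <= #|A|)%N ->
  (forall c, c \in M -> 2 <= #|[set i | E c i]|)%N -> solvable_jets 4 u v.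
Proof.
move=> M4 A3 N2.
have [|i [j [k [l [_ ij kl [ik il jk jl]]]]]] := disjoint_brackets (subxx M) M4.
  by move=> c cM; rewrite bracket_sub; apply: N2.
have [r [q [rA qA rq]]] := card_gt1P (ltnW A3).
pose ws p := [:: e p; pair_form v i j; pair_form v k l].
have wsu p : p \in A -> \prod_(w <- ws p) dot w u != 0.
  by move=> pA; rewrite /ws !big_cons big_nil !mulf_neq0 ?oner_neq0 ?dot_bracket ?dot_supp.
apply: (@solvable_of_conormal_pairs _ _ _ _ _ r (prod_forms (e q :: ws r))).
- by move: rA; rewrite inE.
- apply: avoiding_prod_forms => // [m|] /=.
    by apply: count2; rewrite delta_delta_out ?pair_pair_out // eq_sym.
  by rewrite !dot_pair_form_self eqxx; do 2!case: (_ == _).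
- by rewrite meval_prod_forms big_cons mulf_neq0 ?dot_supp ?wsu.
- move=> s sr.
  have : A :\: [set s; r] != set0.
    rewrite setD_eq0; apply: contraTN A3 => /subset_leq_card.
    by rewrite cards2 sr -ltnNge.
  case/set0Pn => p; rewrite in_setD in_set2 negb_or => /andP[/andP[ps pr] pA].
  apply: (@conormal_pair_prod _ _ _ _ _ s r (ws p)); rewrite ?wsu //.
    by move=> m; apply: count2; rewrite pair_delta_out // pair_pair_out.
  by rewrite /= !dot_pair_form_self eqxx; case: (_ == _).
Qed.


(** The three factors get pairwise disjoint variables. For [pair_form u s t] this needs two disjoint
    brackets avoiding s and t. The obstruction is an index c with exactly three nonzero brackets,
    two of them with s and t; the pair is then reached through c. *)
Lemma solvable_jets3 : (6 <= #|M|)%N -> (4 <= #|A|)%N ->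
  (forall c, c \in M -> 3 <= #|[set i | E c i]|)%N -> solvable_jets 3 u v.
Proof.
move=> M6 A4 N3.
have Es := bracketC u v; have Ei := bracketxx u v.
have cardN1 s c : c \in M :\ s -> (2 <= #|[set i in M :\ s | E c i]|)%N.
  rewrite in_setD1 => /andP[cs cM]; have := N3 c cM; rewrite -bracket_sub => N3c.
  rewrite (_ : [set i in M :\ s | _] = [set i in M | E c i] :\ s); last first.
    by apply/setP => i; rewrite in_set !in_setD1 in_set andbA.
  by apply: (card_setD1_ge s); rewrite N3c.
have [r [q [rA qA rq]]] := card_gt1P (ltnW (ltnW A4)).
have count1 (b1 b2 b3 : bool) : b1 || b2 -> b1 || b3 -> b2 || b3 ->
    (1 < b1 + (b2 + (b3 + 0)))%N.
  by case: b1 b2 b3 => [] [] [].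
have M1 s : (4 <= #|M :\ s|)%N by apply/card_setD1_ge/ltnW.
have ur : u ord0 r != 0 by move: rA; rewrite inE.
have value : exists f0, avoiding_form 3 v f0 /\ ev f0 u != 0.
  have [i [j [k [l [[iW jW kW lW] ij kl [ik il jk jl]]]]]] :=
    disjoint_brackets (subD1set M r) (M1 r) (cardN1 r).
  move: iW jW kW lW; rewrite !in_setD1 => /andP[ir _] /andP[jr _] /andP[kr _] /andP[lr _].
  exists (prod_forms [:: e r; pair_form v i j; pair_form v k l]); split.
    apply: avoiding_prod_forms => // [m|] /=; last first.
      by rewrite !dot_pair_form_self eqxx; case: (_ == _).
    apply: count1; last exact: pair_pair_out;
      by rewrite orbC pair_delta_out // eq_sym.
  by rewrite meval_prod_forms !big_cons big_nil !mulf_neq0 ?oner_neq0 ?dot_bracket ?dot_supp.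
case: value => f0 [f0a f0u].
have pairW s t (W : {set 'I_n}) : W \subset M -> (4 <= #|W|)%N ->
    (forall c, c \in W -> 2 <= #|[set i in W | E c i]|)%N ->
    (forall x, x \in W -> pair_form u s t ord0 x = 0) -> conormal_pair u v 3 s t.
  move=> WM W4 W2 stW.
  have [i [j [k [l [[iW jW kW lW] ij kl [ik il jk jl]]]]]] :=
    disjoint_brackets WM W4 W2.
  apply: (@conormal_pair_prod _ _ _ _ _ s t [:: pair_form v i j; pair_form v k l]) => //.
  - by rewrite !big_cons big_nil !mulf_neq0 ?oner_neq0 ?dot_bracket.
  - have out x y m : x \in W -> y \in W ->
        (pair_form u s t ord0 m == 0) || (pair_form v x y ord0 m == 0).
      move=> xW yW; have [->|mx] := eqVneq m x; first by rewrite stW // eqxx.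
      have [->|my] := eqVneq m y; first by rewrite stW // eqxx.
      by rewrite orbC pair_form_out // eqxx.
    by move=> m; apply: count1; [exact: out | exact: out | exact: pair_pair_out].
  - by rewrite /= !dot_pair_form_self eqxx.
have direct s t : s != t ->
    (forall c, c \in M -> #|[set i | E c i]| = 3%N -> E c s -> E c t -> False) ->
    conormal_pair u v 3 s t.
  move=> st cN; apply: (pairW s t (M :\ s :\ t)).
  - by apply: subset_trans (subD1set _ _) (subD1set _ _).
  - by do 2!apply: card_setD1_ge.
  - move=> c; rewrite !in_setD1 => /and3P[ct cs cM].
    have NE : [set i in M :\ s :\ t | E c i] = [set i | E c i] :\ s :\ t.
      rewrite -bracket_sub; apply/setP => i.
      by rewrite [LHS]in_set !in_setD1 [in RHS]in_set !andbA.
    have setD1_id x (S : {set 'I_n}) : x \notin S -> S :\ x = S.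
      by move=> xS; apply/setDidPl; rewrite disjoint_sym disjoints1.
    have N3c := N3 c cM; rewrite NE.
    have [cs'|cs'] := boolP (E c s); last first.
      by rewrite (setD1_id s) ?inE //; apply: card_setD1_ge.
    have [ct'|ct'] := boolP (E c t); last first.
      by rewrite (setD1_id t) ?inE ?(negbTE ct') ?andbF //; apply: card_setD1_ge.
    apply: card_setD1_ge; apply: card_setD1_ge; rewrite ltn_neqAle N3c andbT eq_sym.
    by apply/eqP => c3; apply: (cN c).
  - by move=> x; rewrite !in_setD1 => /and3P[xt xs _]; rewrite pair_form_out.
apply: (@solvable_of_conormal_pairs _ _ _ _ _ r f0) => // s sr.
have [sA|sA] := boolP (s \in A); last first.
  (* Here the pair form is a multiple of x_s, so only s has to be avoided. *)
  move: sA; rewrite inE negbK => /eqP us.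
  apply: (pairW s r (M :\ s)) => //; first exact: subD1set.
    exact: cardN1.
  move=> x; rewrite in_setD1 => /andP[xs _].
  by rewrite pair_formE us (negbTE xs) mul0r mulr0 subrr.
have [/existsP[c /and4P[cM /eqP N3c cs cr]]|/existsPn noc] := boolP
    [exists c, [&& c \in M, #|[set i | E c i]| == 3%N, E c s & E c r]]; last first.
  apply: direct => // c cM c3 cs cr.
  by have := noc c; rewrite cM c3 eqxx cs cr.
(* If u_c = 0, all of A, at least four indices, has nonzero bracket with c. *)
have uc : u ord0 c != 0.
  apply: contraTneq A4 => uc; rewrite -leqNgt -[X in (_ <= X)%N]N3c; apply: subset_leq_card.
  apply/subsetP => x; rewrite !inE => ux; rewrite /bracket uc mul0r eq_sym.
  by rewrite mulf_eq0 (negbTE ux) /=; move: cM; rewrite !inE uc eqxx.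
(* If [c' c] is nonzero, so is [c' y] for each y in M with [c y] = 0. There are at least three such
   y, and x is a fourth index. *)
have via x : E c x -> forall c', c' \in M -> #|[set i | E c' i]| = 3%N ->
    E c' x -> E c' c -> False.
  move=> cx c' c'M c'3 c'x c'c.
  have sub : x |: (M :\: [set i | E c i]) \subset [set i | E c' i].
    apply/subsetP => y; rewrite in_setU1 => /orP[/eqP ->|]; first by rewrite inE.
    rewrite in_setD in_set => /andP[cy yM]; rewrite in_set.
    apply: contraTT c'c => c'y; apply: (bracketN_trans yM c'y).
    by rewrite Es.
  have MN : #|M| = (3 + #|M :\: [set i | E c i]|)%N.
    have N3M : #|[set i in M | E c i]| = 3%N by rewrite bracket_sub.
    rewrite -(cardsID [set i | E c i] M) -[in RHS]N3M; congr (_ + _)%N.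
    by apply: eq_card => i; rewrite !in_set.
  have := subset_leq_card sub; rewrite c'3 cardsU1 in_setD in_set cx /= add1n.
  by rewrite ltnNge => /negP[]; rewrite -(leq_add2l 3) -MN.
have cs' : c != s by apply: contraTneq cs => ->; rewrite Ei.
have cr' : c != r by apply: contraTneq cr => ->; rewrite Ei.
apply: (conormal_pair_trans uc).
  by apply: direct; [rewrite eq_sym | apply: via].
by apply: direct => // c' c'M c'3 c'c c'r; apply: (via r cr c').
Qed.

End SolvableDegrees.

(** At e_k the form w x_k^(t-1) has the wanted jet and is singular at the other coordinate points
    because t > 2. Its jets at P a and P b are then removed by forms singular at all other
    points. *)
Lemma separates_jets_frame (K : fieldType) (n s t : nat) (P : 'I_s -> 'rV[K]_n)
    (sigma : 'I_n -> 'I_s) a b :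
  (forall k, P (sigma k) = delta_mx ord0 k) ->
  (forall i, [\/ exists k, i = sigma k, i = a | i = b]) ->
  (2 < t)%N -> solvable_jets t (P a) (P b) -> solvable_jets t (P b) (P a) ->
  separates_jets P t.
Proof.
move=> Psigma cover t2 solve_a solve_b i c y eul.
have [[k ik]|ia|ib] := cover i; last first.
- subst i; have [f [[hf fs fa] fc fy]] := solve_b c y eul; exists f; split=> // j jb.
  by have [[k ->]|->|jb'] := cover j; [rewrite Psigma | | rewrite jb' eqxx in jb].
- subst i; have [f [[hf fs fb] fc fy]] := solve_a c y eul; exists f; split=> // j ja.
  by have [[k ->]|ja'|->] := cover j; [rewrite Psigma | rewrite ja' eqxx in ja |].
subst i; rewrite Psigma in eul *.
pose w : 'rV[K]_n := \row_l if l == k then c else y l.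
pose X := nseq t.-1 (delta_mx ord0 k : 'rV[K]_n).
pose f := prod_forms (w :: X).
have hf : f \is t.-homog.
  have := dhomog_prod_forms (w :: X); rewrite /= size_nseq prednK //; exact: ltn_trans t2.
have fs l : l != k -> singular_at f (delta_mx ord0 l).
  move=> lk; apply: singular_prod_forms => /=.
  rewrite /X count_nseq (dot_delta (delta_mx _ k)) [(delta_mx _ k) _ _]mxE.
  by rewrite (negbTE lk) andbF eqxx mul1n; lia.
have Xk : ev (prod_forms X) (delta_mx ord0 k : 'rV[K]_n) = 1.
  rewrite meval_prod_forms big_nseq dot_delta mxE !eqxx /=.
  by elim: t.-1 => //= m ->; rewrite mul1r.
have dX l m : l != k -> dv l (prod_forms (nseq m (delta_mx ord0 k : 'rV[K]_n)))
    (delta_mx ord0 k : 'rV[K]_n) = 0.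
  move=> lk; elim: m => [|m IH].
    by rewrite /prod_forms big_nil -mpolyC1 mderivC meval0.
  by rewrite mderiv_prod_forms IH mulr0 addr0 mxE (negbTE lk) andbF mul0r.
have [fa [[hfa fas fab] fac fay]] := solve_a _ _ (euler (P a) hf).
have [fb [[hfb fbs fba] fbc fby]] := solve_b _ _ (euler (P b) hf).
have fab_sing j : [/\ singular_at fb (P a), singular_at fa (P b)
    & (forall l, singular_at (fa + fb) (delta_mx ord0 l : 'rV[K]_n))].
  by split=> // l; apply: singular_atD.
pose g := f - (fa + fb).
have hg : g \is t.-homog by rewrite rpredB // rpredD.
have gk : ev g (delta_mx ord0 k : 'rV[K]_n) = c.
  have [f0 _] := singular_atD (fas k) (fbs k); rewrite mevalB f0 subr0.
  by rewrite /f prod_forms_cons mevalM Xk mulr1 meval_lin_form dot_delta mxE eqxx.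
exists g; split=> //.
  apply: (@euler_jet_eq _ _ (delta_mx ord0 k) _ _ k).
  - by rewrite mxE !eqxx oner_neq0.
  - move=> l lk; have [_ df0] := singular_atD (fas k) (fbs k).
    rewrite mderivB mevalB df0 subr0 mderiv_prod_forms Xk dX //.
    by rewrite mulr1 mulr0 addr0 mxE (negbTE lk).
  - by rewrite (euler _ hg) gk.
move=> j jk; have [[l jl]|->|->] := cover j.
- subst j; rewrite Psigma /g -scaleN1r; apply: singular_atD.
    by apply: fs; apply: contraNneq jk => ->.
  by apply: singular_atZ; apply: singular_atD.
- case: fba => fb0 dfb0; split=> [|l].
    by rewrite mevalB mevalD fac fb0 addr0 subrr.
  by rewrite mderivB mderivD mevalB mevalD fay dfb0 addr0 subrr.
- case: fab => fa0 dfa0; split=> [|l].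
    by rewrite mevalB mevalD fbc fa0 add0r subrr.
  by rewrite mderivB mderivD mevalB mevalD fby dfa0 add0r subrr.
Qed.

(** * Small supports and few nonzero brackets make T large *)

Lemma vspace_extension (K : fieldType) (V : vectType K) (L : {vspace V}) d :
  (\dim L <= d <= \dim {:V})%N -> exists2 L', (L <= L')%VS & \dim L' = d.
Proof.
case/andP; elim: d => [|d IH].
  by rewrite leqn0 => /eqP dL _; exists L.
rewrite leq_eqVlt => /orP[/eqP dL|dL] dV; first by exists L.
have [L' LL' dL'] := IH dL (ltnW dV).
have /subvPn[x _ xL'] : ~~ (fullv <= L')%VS.
  by apply: contraL dV => /dimvS; rewrite dL' -ltnNge ltnS.
exists (L' + <[x]>)%VS; first exact: subv_trans LL' (addvSl _ _).
have x0 : x != 0 by apply: contraNneq xL' => ->; apply: mem0v.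
rewrite dimv_disjoint_sum ?dL' ?dim_vline ?x0 ?addn1 //.
apply/eqP; rewrite -subv0; apply/subvP => z; rewrite memv_cap => /andP[zL' /vlineP[c zc]].
rewrite memv0 zc scaler_eq0; apply/orP; left; apply: contraNT xL' => c0.
by rewrite -(scalerK c0 x) memvZ // -zc.
Qed.

(** The span of [X] is enlarged to dimension exactly j + 1, as [on_linear_subspace] demands. *)
Lemma T_max_ge (K : fieldType) (n s : nat) (P : 'I_s -> 'rV[K]_n.+1)
    (S : {set 'I_s}) (X : seq 'rV[K]_n.+1) j :
  (0 < j <= n)%N -> (size X <= j.+1)%N ->
  (forall i, i \in S -> P i \in <<X>>%VS) ->
  ((2 * #|S| + j - 2) %/ j <= T_max P)%N.
Proof.
case/andP=> j0 jn Xj SX.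
have /vspace_extension[L XL dL] : (\dim <<X>> <= j.+1 <= \dim {:'rV[K]_n.+1})%N.
  by rewrite (leq_trans (dim_span X) Xj) dimvf /dim /= mul1n ltnS.
have onS : on_linear_subspace P j S.
  by exists L; split=> // i iS; apply: (subvP XL); apply: SX.
have ST : ((2 * #|S| + j - 2) %/ j <= T_sub P j)%N.
  by rewrite /T_sub (bigmax_sup S) //; apply/asboolP.
apply: leq_trans ST _.
by apply: (@leq_bigmax_seq _ _ xpredT (T_sub P)); rewrite // mem_index_iota j0 ltnS.
Qed.

Lemma two_points_outside_frame (K : fieldType) (n : nat)
    (P : 'I_(n + 3) -> 'rV[K]_n.+1) :
  nondegenerate_points P ->
  exists (sigma : 'I_n.+1 -> 'I_(n + 3)) a b,
    [/\ injective sigma, \matrix_k P (sigma k) \in unitmx, a != b,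
      forall k, sigma k != a /\ sigma k != b
      & forall i, [\/ exists k, i = sigma k, i = a | i = b]].
Proof.
move=> Psp; have [r [sigma [sinj _ Nfree span]]] := independent_subfamily P setT.
have rn : r = n.+1.
  apply/eqP; rewrite eqn_leq; apply/andP; split.
    by rewrite -[X in (X <= _)%N](eqP Nfree) rank_leq_col.
  by have := card_subset_rank Psp span; rewrite cardsT card_ord addnC leq_add2l.
subst r; have /cards2P[a [b [ab abE]]] : #|~: [set sigma k | k in 'I_n.+1]| == 2%N.
  have := cardsC [set sigma k | k in 'I_n.+1].
  rewrite card_imset // !card_ord => E.
  by rewrite -(eqn_add2l n.+1) E addnS addnC -addnS addnC.
exists sigma, a, b; split=> // [|k|i]; first by rewrite -row_free_unit.
  have ka x : x \in [set a; b] -> sigma k != x.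
    by rewrite -abE inE; apply: contra => /eqP <-; apply: imset_f.
  by split; apply: ka; rewrite !inE eqxx ?orbT.
have [/imsetP[k _ ->]|iN] := boolP (i \in [set sigma k | k in 'I_n.+1]).
  by apply: Or31; exists k.
have : i \in [set a; b] by rewrite -abE inE.
by rewrite !inE => /orP[/eqP ->|/eqP ->]; [apply: Or32 | apply: Or33].
Qed.

Lemma bracket_swap (K : fieldType) (n : nat) (u v : 'rV[K]_n) i j :
  bracket v u i j = bracket u v i j.
Proof. by rewrite /bracket eq_sym mulrC [v _ _ * _]mulrC. Qed.

Section Configuration.
Variables (K : fieldType) (n s : nat) (P : 'I_s -> 'rV[K]_n.+1).
Variables (sigma : 'I_n.+1 -> 'I_s).
Let N := \matrix_k P (sigma k).
Hypothesis sigma_inj : injective sigma.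

Lemma mem_frame (w : 'rV[K]_n.+1) (R : {set 'I_n.+1}) (U : {vspace 'rV[K]_n.+1}) :
  supp w \subset R -> (forall k, k \in R -> P (sigma k) \in U) -> w *m N \in U.
Proof.
move=> wR RU; rewrite mulmx_sum_row; apply: memv_suml => k _; rewrite rowK.
have [->|wk] := eqVneq (w ord0 k) 0; first by rewrite scale0r mem0v.
by apply: memvZ; apply: RU; apply: (subsetP wR); rewrite inE.
Qed.

Lemma card_frame (R : {set 'I_n.+1}) (Q : {set 'I_s}) :
  (forall k, sigma k \notin Q) -> #|Q :|: [set sigma k | k in R]| = (#|Q| + #|R|)%N.
Proof.
move=> sQ; rewrite cardsU card_imset // (_ : _ :&: _ = set0) ?cards0 ?subn0 //.
apply/setP => i; rewrite !inE; apply/negbTE/negP => /andP[iQ /imsetP[k _ ik]].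
by have := sQ k; rewrite -ik iQ.
Qed.

Lemma T_max_frame (R : {set 'I_n.+1}) (Q : {set 'I_s}) (X : seq 'rV[K]_n.+1) j m :
  (0 < j <= n)%N -> (#|R| + size X <= j.+1)%N -> (forall k, sigma k \notin Q) ->
  (forall i, i \in Q -> exists2 w, supp w \subset R & P i - w *m N \in <<X>>%VS) ->
  (m * j + 2 <= 2 * (#|Q| + #|R|) + j)%N -> (m <= T_max P)%N.
Proof.
move=> jn sizeX sQ QX mj.
pose Y := [seq P (sigma k) | k <- enum R] ++ X.
have RY k : k \in R -> P (sigma k) \in <<Y>>%VS.
  move=> kR; apply: memv_span; rewrite mem_cat.
  by rewrite (map_f (fun k => P (sigma k))) ?mem_enum.
have := @T_max_ge K n s P (Q :|: [set sigma k | k in R]) Y j jn.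
have j0 : (0 < j)%N by case/andP: jn.
rewrite size_cat size_map -cardE => /(_ sizeX) H.
apply: leq_trans (H _).
  by rewrite leq_divRL // card_frame //; lia.
move=> i; rewrite in_setU => /orP[/QX[w wR PX]|/imsetP[k kR ->]]; last exact: RY.
rewrite -(subrK (w *m N) (P i)); apply: memvD.
  by rewrite span_cat (subvP (addvSr _ _)).
exact: mem_frame wR RY.
Qed.

Variables (a b : 'I_s) (u v : 'rV[K]_n.+1).
Hypothesis sa : forall k, sigma k != a.
Hypothesis sb : forall k, sigma k != b.
Hypothesis Pa : P a = u *m N.
Hypothesis Pb : P b = v *m N.

(** If the support has p elements, its frame points and [P a] are p + 1 points on a
    (p-1)-dimensional subspace, so T is at least [(3p - 1)/(p - 1)] = 3 + [2/(p - 1)]. *)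
Lemma supp_gt_T_max m k : (2 <= #|supp u|)%N -> (m * k <= m + 2)%N ->
  (T_max P < m + 3)%N -> (k < #|supp u|)%N.
Proof.
move=> u2 mk; rewrite ltnNge => /negP Tm; rewrite ltnNge; apply/negP => uk; apply: Tm.
have mu := leq_mul (leqnn m) uk.
have un : (#|supp u| <= n.+1)%N by rewrite -[X in (_ <= X)%N]card_ord max_card.
move: u2 mu un; set p := #|supp u| => u2 mu un.
apply: (@T_max_frame (supp u) [set a] [::] (p - 1)); rewrite -/p /=.
- by lia.
- by rewrite addn0; lia.
- by move=> l; rewrite inE.
- by move=> i; rewrite inE => /eqP ->; exists u; rewrite // Pa subrr mem0v.
- by rewrite cards1 mulnDl mulnBr; lia.
Qed.

Hypothesis ab : a != b.

(** Now p + 2 points on a (p-1)-dimensional subspace give T >= 3 + [4/(p - 1)]. *)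
Lemma supp2_gt_T_max m k : (2 <= #|supp u :|: supp v|)%N ->
  (m * k <= m + 4)%N -> (T_max P < m + 3)%N -> (k < #|supp u :|: supp v|)%N.
Proof.
set M := _ :|: _ => M2 mk.
rewrite ltnNge => /negP Tm; rewrite ltnNge; apply/negP => Mk; apply: Tm.
have mM := leq_mul (leqnn m) Mk.
have Mn : (#|M| <= n.+1)%N by rewrite -[X in (_ <= X)%N]card_ord max_card.
move: M2 mM Mn; set p := #|M| => M2 mM Mn.
apply: (@T_max_frame M [set a; b] [::] (p - 1)); rewrite -/p /=.
- by lia.
- by rewrite addn0; lia.
- by move=> l; rewrite !inE negb_or sa sb.
- move=> i; rewrite !inE => /orP[/eqP ->|/eqP ->].
    by exists u; rewrite ?subsetUl // Pa subrr mem0v.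
  by exists v; rewrite ?subsetUr // Pb subrr mem0v.
- by rewrite cards2 ab mulnDl mulnBr; lia.
Qed.

(** The vector v_c u - u_c v has support R. So the frame points of R and the two extra points lie on
    a subspace of dimension p = |R|, and these p + 2 points give T >= 3 + [2/p]. *)
Lemma bracket_gt_T_max m k c : c \in supp u :|: supp v ->
  (0 < #|[set i | bracket u v c i]|)%N -> (m * k <= 2)%N ->
  (T_max P < m + 3)%N -> (k < #|[set i | bracket u v c i]|)%N.
Proof.
set R := [set i | _] => cM R0 mk.
rewrite ltnNge => /negP Tm; rewrite ltnNge; apply/negP => Rk; apply: Tm.
have mR := leq_mul (leqnn m) Rk.
have Rn : (#|R| <= n)%N.
  have : R \subset [set~ c].
    by apply/subsetP => i; rewrite !inE; apply: contraTneq => ->; rewrite bracketxx.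
  by move=> /subset_leq_card; rewrite cardsC1 card_ord.
have suppR (w : 'rV[K]_n.+1) : supp (v ord0 c *: u - u ord0 c *: v) = R.
  apply/setP => i; rewrite !inE !mxE /bracket subr_eq0 eq_sym [v _ _ * _]mulrC.
  by [].
move: R0 mR Rn; set p := #|R| => R0 mR Rn.
have frame (X : seq 'rV[K]_n.+1) : size X = 1%N ->
    (forall i, i \in [set a; b] -> exists2 w, supp w \subset R & P i - w *m N \in <<X>>%VS) ->
    (m + 3 <= T_max P)%N.
  move=> X1 RX; apply: (@T_max_frame R [set a; b] X p); rewrite -/p //.
  - by rewrite R0 Rn.
  - by rewrite X1 addn1.
  - by move=> l; rewrite !inE negb_or sa sb.
  - by rewrite cards2 ab mulnDl; lia.
have supp0 : supp (0 : 'rV[K]_n.+1) \subset R.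
  by apply/subsetP => i; rewrite inE mxE eqxx.
have suppZ (d : K) (w : 'rV[K]_n.+1) : supp w \subset R -> supp (d *: w) \subset R.
  move=> wR; apply: subset_trans wR; apply/subsetP => i.
  by rewrite !inE mxE mulf_eq0 negb_or => /andP[].
(* A point whose coordinate c is nonzero is added to the frame points of R; the other one then lies
   in the span. *)
have [vc|vc] := eqVneq (v ord0 c) 0.
  have uc : u ord0 c != 0 by move: cM; rewrite !inE vc eqxx orbF.
  apply: (frame [:: P a]) => // i; rewrite !inE => /orP[/eqP ->|/eqP ->].
    by exists 0; rewrite // mul0mx subr0 memv_span ?mem_head.
  exists (- (u ord0 c)^-1 *: (v ord0 c *: u - u ord0 c *: v)).
    by apply: suppZ; rewrite suppR.
  rewrite vc scale0r sub0r scaleNr scalerN opprK scalerA mulVf // scale1r.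
  by rewrite -Pb subrr mem0v.
apply: (frame [:: P b]) => // i; rewrite !inE => /orP[/eqP ->|/eqP ->]; last first.
  by exists 0; rewrite // mul0mx subr0 memv_span ?mem_head.
exists ((v ord0 c)^-1 *: (v ord0 c *: u - u ord0 c *: v)).
  by apply: suppZ; rewrite suppR.
rewrite scalerBr scalerA mulVf // scale1r mulmxBl -Pa opprB addrC subrK.
by rewrite scalerA -scalemxAl -Pb memvZ // memv_span ?mem_head.
Qed.

End Configuration.

(** T is compared with 7, 5, 4 and 3: when it is below one threshold, the supports and the sets of
    nonzero brackets are large enough for the products of the next degree. *)
Lemma separates_jets_T_max (K : fieldType) (n : nat)
    (P : 'I_(n + 3) -> 'rV[K]_n.+1) :
  distinct_points P -> nondegenerate_points P -> separates_jets P (T_max P).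
Proof.
move=> Pd Psp; have P0 := Pd.1.
have [sigma [a [b [sinj uN ab sab cover]]]] := two_points_outside_frame Psp.
set N := \matrix_k P (sigma k) in uN.
have Nfree : row_free N by rewrite row_free_unit.
pose u := P a *m invmx N; pose v := P b *m invmx N.
have Pa : P a = u *m N by rewrite mulmxKV.
have Pb : P b = v *m N by rewrite mulmxKV.
have sa k : sigma k != a by case: (sab k).
have sb k : sigma k != b by case: (sab k).
have sep t : (2 < t)%N -> solvable_jets t u v -> solvable_jets t v u ->
    separates_jets P t.
  move=> t2 uv vu; apply: (@separates_jets_unitmx _ _ _ _ _ (invmx N)).
    by rewrite unitmx_inv.
  apply: (separates_jets_frame (sigma := sigma) (a := a) (b := b)) => // k.
  by rewrite -(rowK (fun k => P (sigma k))) -/N rowE mulmxK.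
have two_supp (w : 'rV[K]_n.+1) c : P c = w *m N -> (forall k, sigma k != c) ->
    (2 <= #|supp w|)%N.
  move=> Pc sc; have w0 : w != 0 by apply: contraNneq (P0 c) => w0; rewrite Pc w0 mul0mx.
  have /rV0Pn[i wi] := w0; have [k [ki wk]] := supp_gt1 Pd i Pc sc.
  by apply/card_gt1P; exists k, i; rewrite !inE.
have A2 := two_supp u a Pa sa; have B2 := two_supp v b Pb sb.
have [i [j ij]] := not_proportional Pd ab Pa Pb.
rewrite -/(bracket u v i j) in ij.
have ji : bracket v u i j by rewrite bracket_swap.
set M := supp u :|: supp v.
have M2 : (2 <= #|M|)%N by apply: leq_trans A2 _; rewrite subset_leq_card ?subsetUl.
have vuM : supp v :|: supp u = M by rewrite setUC.
have swapN c : [set i | bracket v u c i] = [set i | bracket u v c i].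
  by apply/setP => k; rewrite !inE bracket_swap.
have N1 c : c \in M -> (0 < #|[set i | bracket u v c i]|)%N.
  move=> cM; rewrite card_gt0; apply: contraTneq ij => N0.
  have cN k : ~~ bracket u v c k by move/setP/(_ k): N0; rewrite !inE => ->.
  by apply: (bracketN_trans cM) => //; rewrite bracketC.
have [T7|T7] := leqP 7 (T_max P).
  apply: (separates_jets_leq P0 T7).
  by apply: sep => //; [apply: solvable_jets7 ij A2 | apply: solvable_jets7 ji B2].
have M3 := supp2_gt_T_max sinj sa sb Pa Pb ab (m := 4) (k := 2) M2 isT T7.
have [T5|T5] := leqP 5 (T_max P).
  apply: (separates_jets_leq P0 T5); apply: sep => //.
    exact: solvable_jets5 ij M3 A2.
  by apply: (solvable_jets5 ji) => //; rewrite vuM.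
have M4 := supp2_gt_T_max sinj sa sb Pa Pb ab (m := 2) (k := 3) M2 isT T5.
have A3 := supp_gt_T_max sinj sa Pa (m := 2) (k := 2) A2 isT T5.
have B3 := supp_gt_T_max sinj sb Pb (m := 2) (k := 2) B2 isT T5.
have [T4|T4] := leqP 4 (T_max P).
  have N2 c (cM : c \in M) := bracket_gt_T_max sinj sa sb Pa Pb ab
    (m := 2) (k := 1) cM (N1 c cM) isT T5.
  apply: (separates_jets_leq P0 T4); apply: sep => //.
    exact: solvable_jets4 M4 A3 N2.
  apply: solvable_jets4 => //; rewrite vuM // => c cM.
  by rewrite swapN; apply: N2.
have M6 := supp2_gt_T_max sinj sa sb Pa Pb ab (m := 1) (k := 5) M2 isT T4.
have A4 := supp_gt_T_max sinj sa Pa (m := 1) (k := 3) A2 isT T4.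
have B4 := supp_gt_T_max sinj sb Pb (m := 1) (k := 3) B2 isT T4.
have N3 c (cM : c \in M) := bracket_gt_T_max sinj sa sb Pa Pb ab
  (m := 1) (k := 2) cM (N1 c cM) isT T4.
(* For m = 0 the bound would hold for every k, and k = n + 1 exceeds what the number of coordinates
   allows. *)
have T3 : (3 <= T_max P)%N.
  rewrite leqNgt; apply/negP => T3.
  have := supp2_gt_T_max sinj sa sb Pa Pb ab (m := 0) (k := n.+1) M2 isT T3.
  by rewrite ltnNge -[X in (_ <= X)%N]card_ord max_card.
apply: (separates_jets_leq P0 T3); apply: sep => //.
  exact: solvable_jets3 M6 A4 N3.
apply: solvable_jets3 => //; rewrite vuM // => c cM.
by rewrite swapN; apply: N3.
Qed.

Theorem proposition4p2 (K : closedFieldType) (n : nat)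
    (P : 'I_(n + 3) -> 'rV[K]_n.+1)
    (P_distinct : distinct_points P)
    (P_nondegenerate : nondegenerate_points P) :
  is_regularity_index P (T_max P).
Proof.
have P0 := P_distinct.1; split.
  by apply/(graded_quotient_dim_double_points _ P0); apply: separates_jets_T_max.
move=> t /(graded_quotient_dim_double_points _ P0) sep.
rewrite /T_max big_seq; apply/bigmax_leqP_seq => j; rewrite mem_index_iota.
move=> /andP[j0 _] _; apply/bigmax_leqP => S /asboolP onS.
exact: separates_jets_bound onS sep.
Qed.
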